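(* Let $\mathcal{G}$ be a second countable, Hausdorff, locally compact, totally disconnected topological group and let $T:\mathcal{G}\to\mathcal{G}$ be a continuous group automorphism. If $T$ is ergodic with respect to Haar measure, then $(\mathcal{G},T)$ is topologically conjugate to $(\Sigma_{\mathcal{G}},\sigma_{\mathcal{G}})$, where $\Sigma_{\mathcal{G}}$ is an inverse limit of full-shifts on finite alphabets and $\sigma_{\mathcal{G}}$ is the map induced by the shift transformation on every level.
   Context: $T$ is ergodic with respect to Haar measure if every $T$-invariant Borel set has Haar measure zero or has complement of Haar measure zero. The full-shift on a finite alphabet $A$ is $A^{\mathbb{Z}}$ (product topology, $A$ discrete) with the shift $\sigma(x)_i=x_{i+1}$. The inverse limit is that of a sequence of full-shifts indexed by $\mathbb{N}$ with bonding maps that are continuous surjections commuting with the shifts. A topological conjugacy is a homeomorphism intertwining the two maps. *)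

(* Defs.v *)
From HB Require Import structures.
From mathcomp Require Import all_boot all_order all_algebra.
From mathcomp Require Import all_classical all_reals all_analysis.

Set Implicit Arguments.
Unset Strict Implicit.
Unset Printing Implicit Defensive.

Import Order.TTheory GRing.Theory Num.Theory.
Local Open Scope classical_set_scope.
Local Open Scope ring_scope.

HB.mixin Record Group_isTopologicalGroup G & Topological G & Group G := {
  mulg_continuous : continuous (fun x : G * G => (x.1 * x.2)%g) ;
  invg_continuous : continuous (fun x : G => (x^-1)%g)
}.

#[short(type="topologicalGroupType")]
HB.structure Definition TopologicalGroup :=
  {G of Topological G & Group G & Group_isTopologicalGroup G}.

(* The carrier of G with its Borel sigma-algebra. A measurableType has to be
   pointed; the distinguished point is the unit of the group. *)
Definition borelType (G : topologicalGroupType) : Type := G.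

Section borelType_instances.
Variable G : topologicalGroupType.
Let opens : set (set (borelType G)) := @open G.

HB.instance Definition _ := Choice.copy (borelType G) G.
HB.instance Definition _ := isPointed.Build (borelType G) (1%g : G).
HB.instance Definition _ := @isMeasurable.Build (sigma_display opens)
  (borelType G) <<s opens >> (@sigma_algebra0 _ setT opens)
  (@sigma_algebraC (borelType G) opens) (@sigma_algebra_bigcup _ setT opens).

End borelType_instances.

(* Left Haar measures: nonzero left-invariant Radon measures. Left and right
   Haar measures have the same null sets, so ergodicity does not depend on the
   side. *)
Record is_haar_measure (R : realType) (G : topologicalGroupType)
    (mu : {measure set (borelType G) -> \bar R}) : Prop := {
  haar_neq0 : mu [set: G] <> 0%E ;
  haar_left_invariant : forall (g : G) (A : set (borelType G)),
    measurable A -> mu [set (g * x)%g | x in (A : set G)] = mu A ;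
  haar_compact : forall K : set G, compact K -> (mu K < +oo)%E ;
  haar_outer_regular : forall A : set (borelType G), measurable A ->
    mu A = ereal_inf [set mu U | U in [set U : set G | open U /\ A `<=` U]] ;
  haar_inner_regular : forall U : set G, open U ->
    mu U = ereal_sup [set mu K | K in [set K : set G | compact K /\ K `<=` U]]
}.

Definition ergodic (d : measure_display) (X : measurableType d) (R : realType)
    (mu : {measure set X -> \bar R}) (T : X -> X) : Prop :=
  forall A : set X, measurable A -> T @^-1` A = A ->
    mu A = 0%E \/ mu (~` A) = 0%E.

Definition homeomorphism (X Y : topologicalType) (h : X -> Y) : Prop :=
  continuous h /\
  exists k : Y -> X, [/\ cancel h k, cancel k h & continuous k].

Definition topologically_conjugate (X Y : topologicalType)
    (f : X -> X) (g : Y -> Y) : Prop :=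
  exists h : X -> Y, homeomorphism h /\ forall x, h (f x) = g (h x).

Definition full_shift (A : finType) : topologicalType :=
  {ptws int -> discrete_topology A}.

Definition shift_map (A : finType) (x : full_shift A) : full_shift A :=
  fun i : int => x (i + 1)%R.

Record full_shift_system := {
  alphabet : nat -> finType ;
  bond : forall n, full_shift (alphabet n.+1) -> full_shift (alphabet n) ;
  bond_continuous : forall n, continuous (@bond n) ;
  bond_surj : forall n, set_surj setT setT (@bond n) ;
  bond_shift : forall n x, bond (shift_map x) = shift_map (@bond n x)
}.

Definition inverse_limit (S : full_shift_system) :
    set (prod_topology (fun n => full_shift (alphabet S n))) :=
  [set x | forall n, @bond S n (x n.+1) = x n].

Lemma shift_inverse_limit (S : full_shift_system)
    (x : prod_topology (fun n => full_shift (alphabet S n))) :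
  inverse_limit x -> @inverse_limit S (fun n => shift_map (x n)).
Proof. by move=> xS n; rewrite bond_shift xS. Qed.

(* The type of points of the inverse limit carries the subspace topology
   inherited from the product. *)
Definition limit_shift (S : full_shift_system)
    (x : set_type (@inverse_limit S)) : set_type (@inverse_limit S) :=
  SigSub (mem_set (shift_inverse_limit (set_valP x))).

Arguments inverse_limit S : clear implicits.
Arguments limit_shift S x : clear implicits.

(* Main.v *)
Require Import Defs.
From HB Require Import structures.
From mathcomp Require Import all_boot all_order all_algebra.
From mathcomp Require Import all_classical all_reals all_analysis.
From mathcomp Require Import zify.

Set Implicit Arguments.
Unset Strict Implicit.
Unset Printing Implicit Defensive.

Import Order.TTheory GRing.Theory Num.Theory.
Local Open Scope classical_set_scope.
Local Open Scope ring_scope.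
Local Open Scope group_scope.

(* Ergodicity makes T topologically transitive, because nonempty open sets have
   positive Haar measure. A compact open subgroup U can be shrunk so that
   U = U+ U-, where U+ (U-) consists of the points whose backward (forward)
   orbit stays in U. The points whose orbit lies in U at all large positive and
   negative times form a relatively compact T-invariant group L, and between two
   visits to U an orbit stays in the compact set L U; a transitive map cannot be
   confined in this way unless G is compact.

   For G compact take a decreasing sequence of open normal subgroups U_n with
   trivial intersection, chosen so that sequences of U_n-cosets with compatible
   neighbours come from points. Following Kitchens, the coset coding of the
   quotient of G by the intersection of all T^i U_n is recoded into a full shift
   by induction on the index of U = U_n. Let H = T(U)U cap T^-1(U)U. If H <> U,
   the symbols inside a coset of H are unconstrained, so a full shift over H/U
   splits off. If H = U, passing from U to T^-1(U)U loses no information. If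
   moreover T^-1(U) is contained in U, transitivity forces U = G. *)

(** * Compactness and topological groups *)

(** The traces of [F] on [K] generate a proper filter, and its cluster point lies in each closed
    member of [F]. *)
Lemma compact_directed (X : topologicalType) (K : set X) (F : set (set X)) :
  compact K -> F !=set0 ->
  (forall A B, F A -> F B -> exists2 C, F C & C `<=` A `&` B) ->
  (forall A, F A -> closed A) -> (forall A, F A -> K `&` A !=set0) ->
  exists2 x, K x & forall A, F A -> A x.
Proof.
move=> cK F0 dF clF KF.
have FF : Filter (filter_from F (setI K)).
  apply: filter_from_filter => // A B FA FB.
  have [C FC CAB] := dF _ _ FA FB; exists C => //.
  by move=> x [Kx /CAB[Ax Bx]].
have PF : ProperFilter (filter_from F (setI K)) by exact: filter_from_proper.
have [|x [Kx clx]] := cK _ PF.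
  by case: F0 => A FA; exists A => // x [].
exists x => // A FA; apply: (clF _ FA) => B Bx.
by apply: clx => //; exists A => // y [].
Qed.

Lemma compact_nested (X : topologicalType) (K : set X) (C : nat -> set X) :
  compact K -> (forall n, closed (C n)) -> (forall n, C n.+1 `<=` C n) ->
  (forall n, K `&` C n !=set0) -> exists2 x, K x & forall n, C n x.
Proof.
move=> cK clC decC KC.
have mono m n : (m <= n)%N -> C n `<=` C m.
  elim: n => [|n IH]; first by rewrite leqn0 => /eqP->.
  by rewrite leq_eqVlt => /predU1P[->//|/IH mn]; apply: subset_trans mn.
have [||||x Kx Cx] := @compact_directed _ K (range C) cK.
- by exists (C 0%N), 0%N.
- move=> _ _ [m _ <-] [n _ <-]; exists (C (maxn m n)).
    by exists (maxn m n).
  by move=> x Cx; split; apply: mono Cx; rewrite (leq_maxl, leq_maxr).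
- by move=> _ [n _ <-].
- by move=> _ [n _ <-].
by exists x => // n; apply: Cx; exists n.
Qed.

Lemma compact_nested_subset (X : topologicalType) (K : set X)
    (C : nat -> set X) (O : set X) :
  compact K -> (forall n, closed (C n)) -> (forall n, C n.+1 `<=` C n) ->
  open O -> (forall x, K x -> (forall n, C n x) -> O x) ->
  exists n, K `&` C n `<=` O.
Proof.
move=> cK clC decC oO KCO; apply: contrapT => /forallNP nO.
have [||n|x Kx Cx] := @compact_nested _ K (fun n => C n `&` ~` O) cK.
- by move=> n; apply: closedI => //; exact: open_closedC.
- by move=> n; apply: setSI.
- by have /existsNP[x /not_implyP[[Kx Cx] nOx]] := nO n; exists x.
have [_] := Cx 0%N; apply; apply: KCO => // n; exact: (Cx n).1.
Qed.

Lemma compact_increasing_cover (X : topologicalType) (K : set X)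
    (O : nat -> set X) :
  compact K -> (forall n, open (O n)) -> (forall n, O n `<=` O n.+1) ->
  K `<=` \bigcup_n O n -> exists n, K `<=` O n.
Proof.
move=> cK oO incO KO; apply: contrapT => /forallNP nO.
have [n|n|n|x Kx nOx] := @compact_nested _ K (fun n => ~` O n) cK.
- exact: open_closedC.
- exact: subsetC.
- by have /existsNP[x /not_implyP[Kx nOx]] := nO n; exists x.
by have [n _] := KO _ Kx; apply: nOx.
Qed.

(** The one-step criterion fits the coset relation: [U (x^-1 * y)] says that [x] and [y] share a
    left coset of [U]. *)
Definition subgroup_set (G : groupType) (U : set G) : Prop :=
  U 1 /\ forall x y, U x -> U y -> U (x^-1 * y).

Section subgroup_set.
Variables (G : groupType) (U : set G).
Hypothesis sU : subgroup_set U.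

Lemma sgV x : U x -> U x^-1.
Proof. by move=> Ux; rewrite -[x^-1]mulg1; apply: sU.2 => //; exact: sU.1. Qed.

Lemma sgM x y : U x -> U y -> U (x * y).
Proof. by move=> /sgV Ux Uy; rewrite -[x]invgK; apply: sU.2. Qed.

Lemma sg_sym x y : U (x^-1 * y) -> U (y^-1 * x).
Proof. by move/sgV; rewrite invgM invgK. Qed.

Lemma sg_trans y x z : U (x^-1 * y) -> U (y^-1 * z) -> U (x^-1 * z).
Proof. by move=> xy yz; rewrite -[z](mulVKg y) mulgA; apply: sgM. Qed.

End subgroup_set.

Lemma sgI (G : groupType) (U V : set G) :
  subgroup_set U -> subgroup_set V -> subgroup_set (U `&` V).
Proof.
move=> sU sV; split; first by split; [exact: sU.1|exact: sV.1].
by move=> x y [Ux Vx] [Uy Vy]; split; [apply: sU.2|apply: sV.2].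
Qed.

Section topological_group.
Variable G : topologicalGroupType.
Implicit Types (U V K : set G).

Lemma continuous_mulg (X : topologicalType) (f g : X -> G) :
  continuous f -> continuous g -> continuous (fun x => f x * g x).
Proof.
move=> cf cg x.
apply: (@cvg_comp _ _ _ (fun x => (f x, g x)) (fun z => z.1 * z.2)).
  by apply: cvg_pair;
    [apply: nbhs_filter|apply: nbhs_filter|exact: cf|exact: cg].
exact: (@mulg_continuous G (f x, g x)).
Qed.

Lemma continuous_invg (X : topologicalType) (f : X -> G) :
  continuous f -> continuous (fun x => (f x)^-1).
Proof.
move=> cf x; apply: (@cvg_comp _ _ _ f (fun y => y^-1)); first exact: cf.
exact: invg_continuous.
Qed.

Lemma continuous_mulgl (a : G) : continuous (fun x : G => a * x).
Proof.
apply: (@continuous_mulg G (fun=> a) id) => x; first exact: cvg_cst.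
exact: cvg_id.
Qed.

Lemma open_cosets U (Z : set G) :
  open U -> open [set x | exists2 z, Z z & U (z^-1 * x)].
Proof.
move=> oU; rewrite (_ : [set x | _] =
    \bigcup_(z in Z) ((fun x => z^-1 * x) @^-1` U)).
  apply: bigcup_open => z _; apply: open_comp oU => x _.
  exact: continuous_mulgl.
by apply/seteqP; split => x [z Zz Ux]; exists z.
Qed.

(** The set is [Z U]; its complement is again a union of open left cosets. *)
Lemma closed_cosets U (Z : set G) :
  open U -> subgroup_set U -> closed [set x | exists2 z, Z z & U (z^-1 * x)].
Proof.
move=> oU sU; set A := [set x | _].
rewrite -[A]setCK; apply: open_closedC.
rewrite (_ : ~` A = [set x | exists2 z, (~` A) z & U (z^-1 * x)]).
  exact: open_cosets.
apply/seteqP; split => x /=.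
  by move=> Ax; exists x => //; rewrite mulVg; exact: sU.1.
move=> [z nAz Uzx] [w Zw Uwx]; apply: nAz; exists w => //.
exact: (sg_trans sU Uwx (sg_sym sU Uzx)).
Qed.

Lemma open_subgroup_closed U : open U -> subgroup_set U -> closed U.
Proof.
move=> oU sU; rewrite (_ : U = [set x | exists2 z, [set 1] z & U (z^-1 * x)]).
  exact: closed_cosets.
apply/seteqP; split => x; first by exists 1 => //; rewrite invg1 mul1g.
by move=> /= [z ->]; rewrite invg1 mul1g.
Qed.

Lemma compact_mul U V : compact U -> compact V ->
  compact [set x | exists u v, [/\ U u, V v & x = u * v]].
Proof.
move=> cU cV.
rewrite (_ : [set x | _] = (fun z : G * G => z.1 * z.2) @` (U `*` V)).
  apply: continuous_compact; last exact: compact_setX.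
  by apply: continuous_subspaceT; exact: mulg_continuous.
apply/seteqP; split => x /=; first by move=> [u [v [Uu Vv ->]]]; exists (u, v).
by move=> [[u v] [/= Uu Vv] <-]; exists u, v.
Qed.

End topological_group.

(** The continuous inverse is part of the data, so that negative iterates are explicit. *)
Record topAut (G : topologicalGroupType) := TopAut {
  fwd :> G -> G ;
  bwd : G -> G ;
  fwdK : cancel fwd bwd ;
  bwdK : cancel bwd fwd ;
  fwdM : {morph fwd : x y / x * y} ;
  fwd_continuous : continuous fwd ;
  bwd_continuous : continuous bwd
}.

(** * Integer iterates of an automorphism *)

Section iterz.
Variables (G : topologicalGroupType) (T : topAut G).

Lemma bwdM : {morph bwd T : x y / x * y}.
Proof. by move=> x y; apply: (can_inj (fwdK T)); rewrite fwdM !bwdK. Qed.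

Lemma fwd1 : T 1 = 1.
Proof. by apply: (mulgI (T 1)); rewrite -fwdM !mulg1. Qed.

Lemma fwdV x : T x^-1 = (T x)^-1.
Proof. by apply: (mulgI (T x)); rewrite -fwdM !mulgV fwd1. Qed.

Definition iterz (i : int) (x : G) : G :=
  match i with
  | Posz n => iter n T x
  | Negz n => iter n.+1 (bwd T) x
  end.

Lemma iterz0 x : iterz 0 x = x. Proof. by []. Qed.

Lemma iterzS i x : iterz (i + 1)%R x = T (iterz i x).
Proof.
case: i => [n|[|n]]; first by rewrite -PoszD addn1.
  by rewrite /= bwdK.
by rewrite (_ : (Negz n.+1 + 1)%R = Negz n) ?NegzE /= ?bwdK; last lia.
Qed.

Lemma iterzP i x : iterz (i - 1)%R x = bwd T (iterz i x).
Proof. by rewrite -{2}[i](subrK 1%R) iterzS fwdK. Qed.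

Lemma iterzD i j x : iterz (i + j)%R x = iterz i (iterz j x).
Proof.
elim/int_rec: i => [|n IH|n IH]; first by rewrite add0r.
  by rewrite -addn1 PoszD addrAC !iterzS IH.
by rewrite -addn1 PoszD opprD addrAC !iterzP IH.
Qed.

Lemma iterzK i x : iterz (- i) (iterz i x) = x.
Proof. by rewrite -iterzD addNr. Qed.

Lemma iterzNK i x : iterz i (iterz (- i) x) = x.
Proof. by rewrite -iterzD addrN. Qed.

Lemma iterzSr i x : iterz i (T x) = T (iterz i x).
Proof. by rewrite -iterzS -[T x]/(iterz 1 x) -iterzD. Qed.

Lemma iterzM i x y : iterz i (x * y) = iterz i x * iterz i y.
Proof.
elim/int_rec: i => [//|n IH|n IH].
  by rewrite -addn1 PoszD !iterzS IH fwdM.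
by rewrite -addn1 PoszD opprD !iterzP IH bwdM.
Qed.

Lemma iterz1 i : iterz i 1 = 1.
Proof. by apply: (mulgI (iterz i 1)); rewrite -iterzM !mulg1. Qed.

Lemma iterzV i x : iterz i x^-1 = (iterz i x)^-1.
Proof. by apply: (mulgI (iterz i x)); rewrite -iterzM !mulgV iterz1. Qed.

Lemma bwdV x : bwd T x^-1 = (bwd T x)^-1.
Proof. exact: (iterzV (-1)%R). Qed.

Lemma iterz_continuous i : continuous (iterz i).
Proof.
elim/int_rec: i => [|n IH|n IH] x; first exact: cvg_id.
  rewrite -addn1 PoszD (_ : iterz _ = T \o iterz n%:Z).
    by apply: (continuous_comp (IH x)); exact: fwd_continuous.
  by apply/funext => y; rewrite iterzS.
rewrite -addn1 PoszD opprD (_ : iterz _ = bwd T \o iterz (- n%:Z)).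
  by apply: (continuous_comp (IH x)); exact: bwd_continuous.
by apply/funext => y; rewrite iterzP.
Qed.

Lemma open_iterz i (U : set G) : open U -> open [set x | U (iterz i x)].
Proof. by move=> oU; apply: open_comp oU => x _; exact: iterz_continuous. Qed.

Lemma closed_iterz i (U : set G) : closed U -> closed [set x | U (iterz i x)].
Proof. by move=> cU; apply: closed_comp cU => x _; exact: iterz_continuous. Qed.

Lemma compact_iterz i (U : set G) :
  compact U -> compact [set x | U (iterz i x)].
Proof.
move=> cU; rewrite (_ : [set x | _] = iterz (- i) @` U).
  apply: continuous_compact cU; apply: continuous_subspaceT.
  exact: iterz_continuous.
apply/seteqP; split => x /=; last by move=> [y Uy <-]; rewrite iterzNK.
by move=> Ux; exists (iterz i x) => //; rewrite iterzK.
Qed.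

Lemma sg_iterz i (U : set G) :
  subgroup_set U -> subgroup_set [set x | U (iterz i x)].
Proof.
move=> sU; split => /=; first by rewrite iterz1; exact: sU.1.
by move=> x y Ux Uy; rewrite iterzM iterzV; apply: sU.2.
Qed.

End iterz.

(** * Factorization U = U+ U- and shadowing *)

Section factorization.
Variables (G : topologicalGroupType) (T : topAut G).
Local Notation tau := (iterz T).
Implicit Types U : set G.

(** This is [U+], the intersection of all [T^n U] with [n >= 0]; [minus_part] is [U-], the
    intersection of all [T^-n U]. *)
Definition plus_part U : set G := [set x | forall n : nat, U (tau (- n%:Z) x)].
Definition minus_part U : set G := [set x | forall n : nat, U (tau n%:Z x)].

Lemma plus_part_sub U : plus_part U `<=` U.
Proof. by move=> x /(_ 0%N). Qed.

Lemma minus_part_sub U : minus_part U `<=` U.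
Proof. by move=> x /(_ 0%N). Qed.

Lemma sg_plus_part U : subgroup_set U -> subgroup_set (plus_part U).
Proof.
move=> sU; split=> [n|x y Ux Uy n]; first exact: (sg_iterz T _ sU).1.
exact: (sg_iterz T _ sU).2.
Qed.

Lemma sg_minus_part U : subgroup_set U -> subgroup_set (minus_part U).
Proof.
move=> sU; split=> [n|x y Ux Uy n]; first exact: (sg_iterz T _ sU).1.
exact: (sg_iterz T _ sU).2.
Qed.

Lemma closed_plus_part U : closed U -> closed (plus_part U).
Proof.
move=> cU; rewrite (_ : plus_part U =
    \bigcap_(n in [set: nat]) [set x | U (tau (- n%:Z) x)]).
  by apply: closed_bigI => n _; exact: closed_iterz.
by apply/seteqP; split => [x Ux n _|x Ux n]; exact: (Ux n).
Qed.

Lemma plus_part_iterz U x (m : nat) :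
  plus_part U x -> plus_part U (tau (- m%:Z) x).
Proof. by move=> Ux n; rewrite -iterzD -opprD -PoszD; exact: Ux. Qed.

Lemma minus_part_iterz U x (m : nat) :
  minus_part U x -> minus_part U (tau m%:Z x).
Proof. by move=> Ux n; rewrite -iterzD -PoszD; exact: Ux. Qed.

(* That is, U = U+ (U cap T^-1 U), with U+ = plus_part U. *)
Definition factorizing U :=
  forall x, U x ->
    exists y, [/\ plus_part U y, U (y^-1 * x) & U (T (y^-1 * x))].

Definition truncated_plus_part U (N : nat) : set G :=
  [set x | forall k : nat, (k <= N)%N -> U (tau (- k%:Z) x)].

Lemma truncated_plus_partS U N :
  truncated_plus_part U N.+1 =
  truncated_plus_part U N `&` [set x | U (tau (- N.+1%:Z) x)].
Proof.
apply/seteqP; split => x.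
  move=> Ux; split=> [k kN|]; first by apply: Ux; exact: leqW.
  exact: (Ux N.+1).
move=> [Ux UNx] k; rewrite leq_eqVlt => /predU1P[->//|].
by rewrite ltnS; exact: Ux.
Qed.

Lemma truncated_plus_part0 U : truncated_plus_part U 0 = U.
Proof.
apply/seteqP; split => x; first by move/(_ 0%N); apply.
by move=> Ux k; rewrite leqn0 => /eqP ->.
Qed.

Lemma open_truncated_plus_part U N : open U -> open (truncated_plus_part U N).
Proof.
move=> oU; elim: N => [|N IH]; first by rewrite truncated_plus_part0.
by rewrite truncated_plus_partS; apply: openI => //; exact: open_iterz.
Qed.

Lemma sg_truncated_plus_part U N :
  subgroup_set U -> subgroup_set (truncated_plus_part U N).
Proof.
move=> sU; split=> [k _|x y Ux Uy k kN]; first exact: (sg_iterz T _ sU).1.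
by apply: (sg_iterz T _ sU).2; [exact: Ux|exact: Uy].
Qed.

(** The truncations [V_N] decrease to [U+], which lies in the open set [O = U+ T^-1(U)], so some
    [V_N] lies in [O]. If [x = y w] is in [V_N] with [y] in [U+] and [T w] in [U], then [w] is in
    [V_N], and so is [T w], whose backward orbit continues with that of [w]. *)
Lemma factorizing_truncation U :
  open U -> compact U -> subgroup_set U ->
  exists N, factorizing (truncated_plus_part U N).
Proof.
move=> oU cU sU.
pose O := [set x | exists2 y, plus_part U y & (T @^-1` U) (y^-1 * x)].
have [||||N NO] := @compact_nested_subset _ U (truncated_plus_part U) O cU.
- move=> n; apply: open_subgroup_closed.
    exact: open_truncated_plus_part.
  exact: sg_truncated_plus_part.
- by move=> n; rewrite truncated_plus_partS; exact: subIsetl.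
- by apply: open_cosets; exact: (open_iterz T 1 oU).
- move=> x Ux Vx; exists x; first by move=> n; exact: (Vx n).
  by rewrite /= mulVg fwd1; exact: sU.1.
exists N => x Vx.
have [|y yp Ty] := NO x; first by split => //; exact: (Vx 0%N).
have Vy : truncated_plus_part U N y by move=> k _; exact: yp.
have sV := sg_truncated_plus_part N sU.
exists y; split.
- by move=> n k _; rewrite -iterzD -opprD -PoszD; exact: yp.
- exact: sV.2.
- move=> [_|k kN]; first exact: Ty.
  rewrite iterzSr -iterzS (_ : (- k.+1%:Z + 1)%R = (- k%:Z)%R); last lia.
  by apply: (sV.2 _ _ Vy Vx); exact: ltnW.
Qed.

Section factorizing.
Variable U : set G.
Hypotheses (clU : closed U) (cU : compact U) (sU : subgroup_set U)
  (fU : factorizing U).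

(** Split off a factor [y0] in [U+], repeat with [T w], and pull the new factor back by [T^-1],
    which preserves [U+]. This controls any finite number of forward iterates; compactness controls
    all of them at once. *)
Lemma plus_minus_factorization x :
  U x -> exists2 y, plus_part U y & minus_part U (y^-1 * x).
Proof.
move=> Ux.
have step n : forall x, U x -> exists2 y, plus_part U y &
    forall k : nat, (k <= n)%N -> U (tau k%:Z (y^-1 * x)).
  elim: n => [|n IH] z Uz.
    exists 1; first exact: (sg_plus_part sU).1.
    by move=> k; rewrite leqn0 => /eqP ->; rewrite invg1 mul1g.
  have [y0 [y0p Uw UTw]] := fU Uz.
  have [y1 y1p Hy1] := IH _ UTw.
  have y1p' : plus_part U (bwd T y1) by exact: (plus_part_iterz 1 y1p).
  exists (y0 * bwd T y1); first exact: (sgM (sg_plus_part sU)).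
  rewrite invgM -mulgA => -[_|k kn].
    exact: (sU.2 _ _ (plus_part_sub y1p') Uw).
  rewrite -[k.+1]addn1 PoszD iterzS -iterzSr.
  by rewrite [T _]fwdM fwdV bwdK; exact: Hy1.
pose D n := plus_part U `&`
  [set y | forall k : nat, (k <= n)%N -> U (tau k%:Z (y^-1 * x))].
have [|n y [yp Hy]|n|y Uy Dy] := @compact_nested _ U D cU.
- move=> n; apply: closedI; first exact: closed_plus_part.
  rewrite (_ : mkset _ = \bigcap_(k in [set k : nat | (k <= n)%N])
      [set y | U (tau k%:Z (y^-1 * x))]).
    apply: closed_bigI => k _.
    apply: (@closed_comp _ _ (fun y => tau k%:Z (y^-1 * x))) clU => y _.
    apply: (@cvg_comp _ _ _ (fun y => y^-1 * x) (tau k%:Z)).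
      apply: (@continuous_mulg G G (fun y => y^-1) (fun=> x)) => z.
        exact: invg_continuous.
      exact: cvg_cst.
    exact: iterz_continuous.
  by apply/seteqP; split => y Hy k kn; exact: Hy.
- by split => // k kn; apply: Hy; exact: leqW.
- by have [y yp Hy] := step n x Ux; exists y; split; [exact: plus_part_sub|].
by exists y; [exact: (Dy 0%N).1|move=> n; exact: (Dy n).2].
Qed.

Lemma minus_plus_factorization x :
  U x -> exists2 y, minus_part U y & plus_part U (y^-1 * x).
Proof.
move=> /(sgV sU)/plus_minus_factorization[y yp ym].
exists (y^-1 * x^-1)^-1; first exact: (sgV (sg_minus_part sU)).
by rewrite invgK mulgVK; exact: (sgV (sg_plus_part sU)).
Qed.

(** Let [g = T^n y] and [b_n = b (m + n)]. Factor [g^-1 b_n u = v w] with [v] in [U+] and [T w] in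
    [U]. Replacing [y] by [y T^-n(v)] keeps the earlier cosets, as the backward orbit of [v] stays
    in [U], and gives [T(b_n u) T(w)^-1] at the next time. *)
Lemma finite_shadowing (b : int -> G) (m : int) (n : nat) :
  (forall i, exists2 u, U u & U ((b (i + 1)%R)^-1 * T (b i * u))) ->
  exists y, forall k : nat, (k <= n)%N -> U ((b (m + k%:Z)%R)^-1 * tau k%:Z y).
Proof.
move=> pb; elim: n => [|n [y Hy]].
  exists (b m) => k; rewrite leqn0 => /eqP ->; rewrite addr0 mulVg.
  exact: sU.1.
have [u Uu Uu'] := pb (m + n%:Z)%R; set bn := b (m + n%:Z)%R in Uu'.
set g := tau n%:Z y.
have Ug : U (bn^-1 * g) by exact: Hy.
have [v [vp Uw UTw]] := fU (sU.2 _ _ Ug Uu).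
exists (y * tau (- n%:Z) v) => k; rewrite leq_eqVlt => /predU1P[->|kn].
  rewrite -addn1 PoszD addrA iterzS iterzM iterzNK -/g.
  rewrite (_ : g * v = bn * u * (v^-1 * ((bn^-1 * g)^-1 * u))^-1).
    by rewrite [T _]fwdM fwdV mulgA; apply: (sgM sU) => //; exact: (sgV sU).
  by rewrite !(invgM, invgK) !mulgA mulgK mulgV mul1g.
rewrite iterzM mulgA; apply: (sgM sU); first exact: Hy.
rewrite -iterzD (_ : (k%:Z - n%:Z)%R = (- (n - k)%N%:Z)%R); last lia.
exact: vp.
Qed.

Lemma shadowing (b : int -> G) :
  (forall i, exists2 u, U u & U ((b (i + 1)%R)^-1 * T (b i * u))) ->
  exists y, forall i, U ((b i)^-1 * tau i y).
Proof.
move=> pb.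
pose C n := [set y | forall i : int, (`|i| <= n)%N -> U ((b i)^-1 * tau i y)].
have cK : compact [set y | U ((b 0%R)^-1 * y)].
  rewrite (_ : mkset _ = (fun y => b 0%R * y) @` U).
    apply: continuous_compact cU; apply: continuous_subspaceT.
    exact: continuous_mulgl.
  apply/seteqP; split => y /=; last by move=> [z Uz <-]; rewrite mulKg.
  by move=> Uy; exists ((b 0%R)^-1 * y) => //; rewrite mulVKg.
have [|n y Hy i ik|n|y _ Cy] := @compact_nested _ _ C cK.
- move=> n; rewrite (_ : C n = \bigcap_(i in [set i : int | (`|i| <= n)%N])
      [set y | U ((b i)^-1 * tau i y)]).
    apply: closed_bigI => i _.
    apply: (@closed_comp _ _ (fun y => (b i)^-1 * tau i y)) clU => y _.
    apply: (@cvg_comp _ _ _ (tau i) (fun y => (b i)^-1 * y)).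
      exact: iterz_continuous.
    exact: continuous_mulgl.
  by apply/seteqP; split => y Hy i ik; exact: Hy.
- by apply: Hy; exact: leqW.
(* The segment covers the times from [-n] to [n], so its point at time 0 is [T^n y]. *)
- have [y Hy] := @finite_shadowing b (- n%:Z)%R (n + n) pb.
  exists (tau n%:Z y); have Cy : C n (tau n%:Z y).
    move=> i ik; have := Hy (absz (i + n%:Z)%R).
    rewrite (_ : (absz (i + n%:Z)%R)%:Z = (i + n%:Z)%R); last lia.
    rewrite (_ : (- n%:Z + (i + n%:Z))%R = i) ?iterzD; last lia.
    by apply; lia.
  by split => //; exact: (Cy 0%R).
by exists y => i; exact: (Cy `|i|%N).
Qed.

End factorizing.
End factorization.

(** * Transitive automorphisms live on compact groups *)

Section recurrence.
Variables (G : topologicalGroupType) (T : topAut G).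
Local Notation tau := (iterz T).
Hypothesis hG : hausdorff_space G.

Definition top_transitive := forall O V : set G,
  open O -> open V -> O !=set0 -> V !=set0 ->
  exists i x, O x /\ V (tau i x).

Hypothesis trT : top_transitive.

(** Without isolated points [B] contains some [z] other than [f y]; disjoint neighbourhoods of [z]
    and [f y] cut out [B'] and [A']. *)
Lemma separate_image (f : G -> G) (A B : set G) :
  (forall x : G, ~ open [set x]) -> continuous f -> open A -> open B ->
  A !=set0 -> B !=set0 ->
  exists A' B', [/\ open A' /\ A' !=set0, open B' /\ B' !=set0,
    A' `<=` A, B' `<=` B & forall x, A' x -> ~ B' (f x)].
Proof.
move=> noiso cf oA oB [y Ay] [z0 Bz0].
have [z [Bz zfy]] : exists z, B z /\ z <> f y.
  apply: contrapT => nz; apply: (noiso (f y)).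
  rewrite (_ : [set f y] = B) //; apply/seteqP; split => [_ ->|w Bw].
    have [<-//|ne] := pselect (z0 = f y).
    by exfalso; apply: nz; exists z0.
  by apply: contrapT => wfy; apply: nz; exists w.
move: (hG); rewrite open_hausdorff => /(_ (f y) z).
case=> [|[P Q] /= [Pfy Qz] [oP oQ PQ0]]; first by apply/eqP => /esym.
exists (A `&` f @^-1` P), (B `&` Q); split.
- split; first by apply: openI => //; apply: open_comp oP => x _; exact: cf.
  by exists y; split => //; rewrite inE in Pfy.
- by split; [exact: openI|exists z; split => //; rewrite inE in Qz].
- by move=> x [].
- by move=> x [].
move=> x [_ Px] [_ Qx]; have : (P `&` Q) (f x) by [].
by move/eqP: PQ0 => ->.
Qed.

(** Shrink [W] to nonempty open [A] and [B] such that no [T^k] with [|k| < n] takes a point of [A]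
    into [B]. Transitivity then yields a time [i] with [|i| >= n]; if [i] is negative, the orbit
    segment is read from its other end. *)
Lemma far_return (W : set G) (n : nat) :
  (forall x : G, ~ open [set x]) -> open W -> W !=set0 ->
  exists k : nat, (n <= k)%N /\ exists x, W x /\ W (tau k%:Z x).
Proof.
move=> noiso oW W0.
have [A [B [[oA A0] [oB B0] AW BW AB]]] : exists A B,
    [/\ open A /\ A !=set0, open B /\ B !=set0, A `<=` W, B `<=` W &
    forall k : nat, (k < n)%N -> forall x, A x ->
      ~ B (tau k%:Z x) /\ ~ B (tau (- k%:Z) x)].
  elim: n => [|n [A [B [[oA A0] [oB B0] AW BW AB]]]].
    by exists W, W; split => // k; rewrite ltn0.
  have [A1 [B1 [[oA1 A10] [oB1 B10] AA1 BB1 AB1]]] := separate_image noiso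
    (@iterz_continuous _ T n%:Z) oA oB A0 B0.
  have [A2 [B2 [[oA2 A20] [oB2 B20] AA2 BB2 AB2]]] := separate_image noiso
    (@iterz_continuous _ T (- n%:Z)) oA1 oB1 A10 B10.
  exists A2, B2; split => //.
  - by move=> x /AA2/AA1/AW.
  - by move=> x /BB2/BB1/BW.
  move=> k; rewrite ltnS leq_eqVlt => /predU1P[-> x A2x|kn x A2x].
    by split; [move/BB2; apply: AB1; exact: AA2|exact: AB2].
  have [nB nB'] := AB _ kn _ (AA1 _ (AA2 _ A2x)).
  by split=> /BB2/BB1.
have [i [x [Ax Bx]]] := trT oA oB A0 B0.
have ni : (n <= `|i|)%N.
  rewrite leqNgt; apply/negP => /AB/(_ x Ax)[nB nB'].
  have [i0|i0] := leP 0%R i.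
    by apply: nB; rewrite gez0_abs.
  by apply: nB'; rewrite ltz0_abs // opprK.
exists `|i|%N; split => //.
have [i0|i0] := leP 0%R i.
  by exists x; rewrite gez0_abs //; split; [exact: AW|exact: BW].
exists (tau i x); rewrite ltz0_abs // iterzK; split; first exact: BW.
exact: AW.
Qed.

Lemma no_isolated_point (g : G) : ~ open [set (1 : G)] -> ~ open [set g].
Proof.
move=> n1 og; apply: n1.
rewrite (_ : [set 1] = (fun x => g * x) @^-1` [set g]).
  by apply: open_comp og => x _; exact: continuous_mulgl.
apply/seteqP; split => x /=; first by move=> ->; rewrite mulg1.
by move=> gx; apply: (mulgI g); rewrite gx mulg1.
Qed.

(* A point of O leaving O' would never come back to O, whereas far_return
   produces such returns. *)
Lemma transitive_confinement (O O' : set G) :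
  open O -> O 1 -> closed O' ->
  (forall x (m k : nat), (k <= m)%N -> O x -> O (tau m%:Z x) ->
    O' (tau k%:Z x)) ->
  O' = setT.
Proof.
move=> oO O1 cO' OO'.
(* If [{1}] is open, so is every [{x}], and transitivity gives [x = T^i 1 = 1]: the group is
   trivial. *)
have [iso|noiso] := pselect (open [set (1 : G)]).
  apply/seteqP; split => // x _.
  have ox : open [set x].
    rewrite (_ : [set x] = (fun y => x^-1 * y) @^-1` [set 1]).
      by apply: open_comp iso => y _; exact: continuous_mulgl.
    apply/seteqP; split => y /=; first by move=> ->; rewrite mulVg.
    by move=> xy; apply: (mulgI x^-1); rewrite xy mulVg.
  have [i [y [/= -> ]]] := trT iso ox (ex_intro _ 1 erefl) (ex_intro _ x erefl).
  rewrite iterz1 => <-.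
  by have := OO' 1 0%N 0%N; rewrite iterz0; exact.
have {}noiso (x : G) : ~ open [set x] by exact: no_isolated_point.
apply/seteqP; split => // z _; apply: contrapT => O'z.
have oC : open (~` O') by exact: closed_openC.
have [i [x [Ox O'x]]] := trT oO oC (ex_intro _ 1 O1) (ex_intro _ z O'z).
pose W := O `&` [set x | ~ O' (tau i x)].
have oW : open W by apply: openI => //; exact: (open_iterz T i oC).
have [|k [ik [y [[Oy O'y] [Oky O'ky]]]]] := @far_return W `|i|%N noiso oW.
  by exists x.
(* Both [T^i y] and [T^(i+k) y] are outside [O'], and since [|i| <= k] one of the times [i], [i + k]
   lies between the visits at 0 and [k]. *)
have [i0|i0] := leP 0%R i.
  by apply: O'y; rewrite -(gez0_abs i0); exact: (OO' y k).
apply: O'ky; rewrite -iterzD.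
rewrite (_ : (i + k%:Z)%R = (k - `|i|)%N%:Z); last lia.
by apply: (OO' y k) => //; exact: leq_subr.
Qed.

End recurrence.

(** * Bounded orbits and compactness of the group *)

Section compactness.
Variables (G : topologicalGroupType) (T : topAut G).
Local Notation tau := (iterz T).
Variable U : set G.
Hypotheses (hG : hausdorff_space G) (oU : open U) (cU : compact U)
  (sU : subgroup_set U) (fU : factorizing T U).
Local Notation Up := (plus_part T U).
Local Notation Um := (minus_part T U).

Let clU : closed U. Proof. exact: open_subgroup_closed. Qed.

(** The group [L] of the overview: the union of the [T^m U+] intersected with the union of the
    [T^-n U-]. *)
Definition bounded_orbits : set G := [set x |
  (exists m : nat, Up (tau (- m%:Z) x)) /\ exists n : nat, Um (tau n%:Z x)].
Local Notation H := bounded_orbits.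

Lemma bounded_orbits_iterz i x : H x -> H (tau i x).
Proof.
move=> [[m xm] [n xn]]; split.
  exists (m + `|i|)%N; rewrite -iterzD.
  have [i0|i0] := leP 0%R i.
    by rewrite (_ : (_ + _)%R = (- m%:Z)%R) //; lia.
  rewrite (_ : (_ + _)%R = (- (`|i| + `|i|)%N%:Z + - m%:Z)%R); last lia.
  by rewrite iterzD; exact: plus_part_iterz.
exists (n + `|i|)%N; rewrite -iterzD.
have [i0|i0] := leP 0%R i.
  rewrite (_ : (_ + _)%R = ((`|i| + `|i|)%N%:Z + n%:Z)%R); last lia.
  by rewrite iterzD; exact: minus_part_iterz.
by rewrite (_ : (_ + _)%R = n%:Z) //; lia.
Qed.

Lemma plus_part_bwd x : U x -> Up (bwd T x) -> Up x.
Proof.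
move=> Ux Ubx [|n]; first by rewrite oppr0 iterz0.
have := Ubx n; rewrite -[bwd T x]/(tau (-1)%R x) -iterzD.
by rewrite (_ : (- n%:Z + -1)%R = (- n.+1%:Z)%R); last lia.
Qed.

(* Since T U+ is compact, finitely many cosets of U+ in it meet H. *)
Lemma bounded_orbits_reps : exists N : nat, forall x, H x -> Up (bwd T x) ->
  exists z, [/\ H z, Um (tau N%:Z z) & Up (z^-1 * x)].
Proof.
pose Z n := [set z | [/\ H z, Up (bwd T z) & Um (tau n%:Z z)]].
pose Z' := [set z | H z /\ Up (bwd T z)].
pose O n := [set x | exists2 z, Z n z & U (z^-1 * x)].
have clp : closed Up by exact: closed_plus_part.
(* The increasing open sets [O n = Z n U] cover this compact set, because [Z'] is the union of the
   [Z n]. *)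
have cK : compact ([set x | Up (bwd T x)] `&`
    [set x | exists2 z, Z' z & U (z^-1 * x)]).
  apply: compact_closedI; last exact: closed_cosets.
  rewrite -[mkset _]/[set x | Up (tau (-1)%R x)]; apply: compact_iterz.
  apply: subclosed_compact cU _ => //.
  exact: plus_part_sub.
have [n|n x [z [Hz zp zm] Uz]|x [xp [z [Hz zp] Uz]]|N KN] :=
    @compact_increasing_cover _ _ O cK.
- exact: open_cosets.
- exists z => //; split => //; rewrite -addn1 addnC PoszD iterzD.
  exact: (minus_part_iterz 1 zm).
- have [_ [n zm]] := Hz.
  by exists n => //; exists z.
exists N => x Hx xp; have [|z [Hz zp zm] Uz] := KN x.
  by split => //; exists x => //; rewrite mulVg; exact: sU.1.
exists z; split => //; apply: plus_part_bwd => //.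
by rewrite bwdM bwdV; exact: (sg_plus_part T sU).2.
Qed.

(** Induction on [k] with [T^-k x] in [U+]. In the step to [k + 1] with [k >= N], a representative
    [z] of [T^-k x] gives [x = T^k(z) y] with [T^k z] in [U-] and [T^-k y] in [U+], and induction
    applies to [y]. *)
Lemma bounded_orbits_relatively_compact : exists N : nat, forall x, H x ->
  exists u v, [/\ Um u, Up (tau (- N%:Z) v) & x = u * v].
Proof.
have [N HN] := bounded_orbits_reps; exists N.
have sUp := sg_plus_part T sU; have sUm := sg_minus_part T sU.
have main (k : nat) : forall x, H x -> Up (tau (- k%:Z) x) ->
    exists u v, [/\ Um u, Up (tau (- N%:Z) v) & x = u * v].
  elim: k => [|k IH] x Hx xp.
    exists 1, x; rewrite mul1g; split => //; first exact: sUm.1.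
    exact: plus_part_iterz.
  have [kN|Nk] := leqP k.+1 N.
    exists 1, x; rewrite mul1g; split => //; first exact: sUm.1.
    rewrite (_ : (- N%:Z)%R = (- (N - k.+1)%N%:Z + - k.+1%:Z)%R); last lia.
    by rewrite iterzD; exact: plus_part_iterz.
  have [||z [Hz zm zp]] := HN (tau (- k%:Z) x).
  - exact: bounded_orbits_iterz.
  - rewrite -[bwd T _]/(tau (-1)%R _) -iterzD.
    by rewrite (_ : (_ + _)%R = (- k.+1%:Z)%R) //; lia.
  have [||u [v [um vp yE]]] := IH (tau k%:Z (z^-1 * tau (- k%:Z) x)).
  - apply: bounded_orbits_iterz; split; first by exists 0%N; exact: zp.
    have [_ [n1 zn]] := Hz.
    have [_ [n2 xn]] := bounded_orbits_iterz (- k%:Z) Hx.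
    exists (n1 + n2)%N; rewrite iterzM iterzV; apply: sUm.2.
      by rewrite addnC PoszD iterzD; exact: minus_part_iterz.
    by rewrite PoszD iterzD; exact: minus_part_iterz.
  - by rewrite iterzK.
  exists (tau k%:Z z * u), v; split => //.
    apply: (sgM sUm) => //.
    rewrite (_ : k%:Z = ((k - N)%N%:Z + N%:Z)%R); last lia.
    by rewrite iterzD; exact: minus_part_iterz.
  by rewrite -mulgA -yE iterzM iterzV iterzNK mulVKg.
by move=> x Hx; have [[m xm] _] := Hx; exact: main xm.
Qed.

(** Confinement is applied to the compact set [W = U T^N(U+) U]. If [x] and [T^m x] are in [U],
    write [x = x1 x2] in [U+ U-] and [T^m x1 = y1 y2] in [U- U+]. Then [T^-m y1] is in [H], and
    [T^k x] is the product of [T^(k-m) y1], [T^(k-m) y2] and [T^k x2], the last two lying in [U]. *)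
Lemma transitive_compact : top_transitive T -> compact [set: G].
Proof.
move=> trT; have [N HN] := bounded_orbits_relatively_compact.
have sUp := sg_plus_part T sU; have sUm := sg_minus_part T sU.
have cUp : compact Up.
  apply: subclosed_compact cU (@plus_part_sub _ T U).
  exact: closed_plus_part.
pose V := [set x | exists u v,
  [/\ U u, [set v | Up (tau (- N%:Z) v)] v & x = u * v]].
have cV : compact V by apply: compact_mul => //; exact: compact_iterz.
pose W := [set x | exists u v, [/\ V u, U v & x = u * v]].
have cW : compact W by exact: compact_mul.
suff <- : W = setT by [].
apply: (transitive_confinement hG trT oU) => //.
- exact: sU.1.
- exact: compact_closed.
move=> x m k km Ux Umx.
have [x1 x1p x1m] := plus_minus_factorization clU cU sU fU Ux.
set x2 := x1^-1 * x in x1m.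
have Ux1 : U (tau m%:Z x1).
  rewrite -[x1](mulgK x2) /x2 mulVKg iterzM iterzV.
  apply: (sgM sU) => //; apply: (sgV sU); exact: x1m.
have [y1 y1m y1p] := minus_plus_factorization clU cU sU fU Ux1.
set y2 := y1^-1 * _ in y1p.
have Hz : H (tau (- m%:Z) y1).
  split; last by exists m; rewrite iterzNK.
  exists 0%N; rewrite oppr0 iterz0.
  rewrite (_ : tau (- m%:Z) y1 = x1 * (tau (- m%:Z) y2)^-1).
    apply: (sgM sUp) => //; apply: (sgV sUp); exact: plus_part_iterz.
  by rewrite /y2 iterzM iterzV iterzK invgM invgK mulVKg.
have [u [v [um vp uvE]]] := HN _ (bounded_orbits_iterz k%:Z Hz).
exists (u * v), (tau (k%:Z - m%:Z) y2 * tau k%:Z x2); split.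
- by exists u, v; split => //; exact: minus_part_sub.
- apply: (sgM sU); last exact: x1m.
  by rewrite (_ : (k%:Z - m%:Z)%R = (- (m - k)%N%:Z)%R) //; lia.
rewrite -uvE mulgA (_ : _ * tau (k%:Z - m%:Z) y2 = tau k%:Z x1).
  by rewrite -iterzM /x2 mulVKg.
by rewrite -iterzD /y2 iterzM iterzV mulVKg -iterzD subrK.
Qed.

End compactness.

(** * Coding by full shifts *)

Section subgroup_products.
Variable G : groupType.
Implicit Types M N U : set G.

Definition normal_set U : Prop := forall g x, U x -> U (g^-1 * x * g).

Definition mul_set M N : set G :=
  [set x | exists m n, [/\ M m, N n & x = m * n]].

Lemma coset_mull (g x y : G) : (g * x)^-1 * (g * y) = x^-1 * y.
Proof. by rewrite invgM -mulgA mulKg. Qed.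

Lemma sub_mul_setl M N : subgroup_set N -> M `<=` mul_set M N.
Proof.
by move=> sN x Mx; exists x, 1; rewrite mulg1; split => //; exact: sN.1.
Qed.

Lemma sub_mul_setr M N : subgroup_set M -> N `<=` mul_set M N.
Proof.
by move=> sM x Nx; exists 1, x; rewrite mul1g; split => //; exact: sM.1.
Qed.

Lemma sg_mul_set M N :
  subgroup_set M -> subgroup_set N -> normal_set M ->
  subgroup_set (mul_set M N).
Proof.
move=> sM sN nM; split; first by apply: sub_mul_setl => //; exact: sM.1.
move=> _ _ [m [n [Mm Nn ->]]] [m' [n' [Mm' Nn' ->]]].
exists (n^-1 * (m^-1 * m') * n), (n^-1 * n'); split.
- by apply: nM; exact: sM.2.
- exact: sN.2.
- by rewrite invgM !mulgA mulgK.
Qed.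

Lemma normal_mul_set M N :
  normal_set M -> normal_set N -> normal_set (mul_set M N).
Proof.
move=> nM nN g _ [m [n [Mm Nn ->]]].
exists (g^-1 * m * g), (g^-1 * n * g); split; [exact: nM|exact: nN|].
by rewrite !mulgA mulgK.
Qed.

Lemma coset_representatives U : subgroup_set U ->
  exists r : G -> G, (forall x, U (x^-1 * r x)) /\
    forall x y, U (x^-1 * y) -> r x = r y.
Proof.
move=> sU; exists (fun x => xget 1 [set y | U (x^-1 * y)]); split=> [x|x y Uxy].
  apply: (@xgetPex _ 1 [set y | U (x^-1 * y)]).
  by exists x; rewrite /= mulVg; exact: sU.1.
congr xget; apply/seteqP; split => z /=.
  exact: (sg_trans sU (sg_sym sU Uxy)).
exact: (sg_trans sU Uxy).
Qed.

End subgroup_products.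

(** Makes the induction measure of [full_shift_code_exists] strictly decrease. *)
Lemma count_lt (X : eqType) (a b : pred X) (s : seq X) (z : X) :
  subpred a b -> z \in s -> ~~ a z -> b z -> (count a s < count b s)%N.
Proof.
move=> ab zs naz bz; elim: s zs => // x s IH; rewrite inE => /predU1P[<-|zs] /=.
  by rewrite (negbTE naz) bz add0n add1n ltnS; exact: sub_count.
rewrite -addnS leq_add //; last exact: IH.
by case: (a x) (ab x) => // ->.
Qed.

Section open_subgroups.
Variable G : topologicalGroupType.
Implicit Types U V : set G.

Lemma open_supergroup U V :
  open U -> subgroup_set U -> subgroup_set V -> U `<=` V -> open V.
Proof.
move=> oU sU sV UV.
rewrite (_ : V = [set x | exists2 z, V z & U (z^-1 * x)]).
  exact: open_cosets.
apply/seteqP; split => x /=.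
  by move=> Vx; exists x => //; rewrite mulVg; exact: sU.1.
by move=> [z Vz /UV Vzx]; rewrite -(mulVKg z x); exact: sgM.
Qed.

Lemma finite_cosets U : compact [set: G] -> open U -> subgroup_set U ->
  exists l : seq G, forall x, exists2 z, z \in l & U (z^-1 * x).
Proof.
move=> cG oU sU.
pose C (l : seq G) := [set x | exists2 z, [set z | z \in l] z & U (z^-1 * x)].
apply: contrapT => /forallNP nl.
have [|_ _ [l _ <-] [l' _ <-]|_ [l _ <-]|_ [l _ <-]|x _ Cx] :=
    @compact_directed _ _ [set ~` C l | l in [set: seq G]] cG.
- by exists (~` C [::]), [::].
- exists (~` C (l ++ l')); first by exists (l ++ l').
  by move=> x nC; split => -[z zl Uzx]; apply: nC; exists z => //=;
    rewrite mem_cat zl ?orbT.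
- by apply: open_closedC; exact: open_cosets.
- have /existsNP[x nx] := nl l; by exists x.
have : (~` C [:: x]) x by apply: Cx; exists [:: x].
by apply; exists x; rewrite /= ?mem_head // mulVg; exact: sU.1.
Qed.

End open_subgroups.

Section full_shift_coding.
Variables (G : topologicalGroupType) (T : topAut G).
Local Notation tau := (iterz T).
Hypotheses (hG : hausdorff_space G) (cG : compact [set: G])
  (trT : top_transitive T).
Implicit Types U : set G.

(* Read x as the sequence of its symbols T^i x U. A symbol b U may follow a U
   exactly when T(a)^-1 b lies in T(U) U. *)
Definition followers U := mul_set [set x | U (bwd T x)] U.
Definition predecessors U := mul_set [set x | U (T x)] U.

(** Coset itineraries form a one-step Markov shift: what is allowed step by step is realised by a
    point. *)
Definition shadowed U := forall b : int -> G,
  (forall i, followers U ((b (i + 1)%R)^-1 * T (b i))) ->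
  exists y, forall i, U ((b i)^-1 * tau i y).

(** Together the clauses say that [phi]-itineraries identify [G] modulo the intersection of all
    [T^i U] with the full shift over [A]. *)
Definition full_shift_code U (A : finType) (phi : G -> A) :=
  [/\ forall x u, U u -> phi (x * u) = phi x,
      forall x y, (forall i, phi (tau i x) = phi (tau i y)) ->
        forall i, U (tau i (x^-1 * y)) &
      forall a : int -> A, exists x, forall i, phi (tau i x) = a i].

Lemma sg_fwd U : subgroup_set U -> subgroup_set [set x | U (T x)].
Proof. exact: (@sg_iterz _ T 1%R). Qed.

Lemma sg_bwd U : subgroup_set U -> subgroup_set [set x | U (bwd T x)].
Proof. exact: (@sg_iterz _ T (-1)%R). Qed.

Lemma normal_fwd U : normal_set U -> normal_set [set x | U (T x)].
Proof. by move=> nU g x /(nU (T g)); rewrite /= !fwdM fwdV. Qed.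

Lemma normal_bwd U : normal_set U -> normal_set [set x | U (bwd T x)].
Proof. by move=> nU g x /(nU (bwd T g)); rewrite /= !bwdM bwdV. Qed.

(** For a normal subgroup [U], multiplying a symbol on the right by an element of this set changes
    neither its possible predecessors nor its possible successors. *)
Definition free_symbols U := followers U `&` predecessors U.

Section one_subgroup.
Variable U : set G.
Hypotheses (sU : subgroup_set U) (nU : normal_set U).

Lemma sg_followers : subgroup_set (followers U).
Proof. by apply: sg_mul_set => //; [exact: sg_bwd|exact: normal_bwd]. Qed.

Lemma sg_predecessors : subgroup_set (predecessors U).
Proof. by apply: sg_mul_set => //; [exact: sg_fwd|exact: normal_fwd]. Qed.

Lemma normal_followers : normal_set (followers U).
Proof. by apply: normal_mul_set => //; exact: normal_bwd. Qed.

Lemma normal_predecessors : normal_set (predecessors U).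
Proof. by apply: normal_mul_set => //; exact: normal_fwd. Qed.

Lemma followers_fwd x : U x -> followers U (T x).
Proof. by move=> Ux; apply: (sub_mul_setl sU); rewrite /= fwdK. Qed.

Lemma followers_sub : U `<=` followers U.
Proof. exact: (sub_mul_setr (sg_bwd sU)). Qed.

Lemma predecessors_sub : U `<=` predecessors U.
Proof. exact: (sub_mul_setr (sg_fwd sU)). Qed.

Lemma predecessors_followers x : predecessors U x -> followers U (T x).
Proof.
move=> [w [u [Uw Uu ->]]]; rewrite fwdM.
by apply: (sgM sg_followers); [exact: followers_sub|exact: followers_fwd].
Qed.

Lemma factorizing_shadowed :
  closed U -> compact U -> factorizing T U -> shadowed U.
Proof.
move=> clU cU fU b pb; apply: (shadowing clU cU sU fU) => i.
(* Here [T(b_i)^-1 b_(i+1) = m n] with [m] in [T(U)]; the choice [u = T^-1 m] gives a point of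
   [b_i U] whose image is in [b_(i+1) U]. *)
have [m [n [Um Un E]]] := sgV sg_followers (pb i).
exists (bwd T m) => //; rewrite fwdM bwdK mulgA.
rewrite (_ : _ * T (b i) * m = n^-1); first exact: sgV.
by rewrite -[_ * T (b i)]invgK E invgM mulgVK.
Qed.

(** Each step is some [g_i] in [T^-1(U)] times an element of [followers U]. The corrected sequence
    [b_i g_(i-1)] is allowed for [U], and [g_(i-1) U] lies in [T^-1(U) U]. *)
Lemma shadowed_predecessors : shadowed U -> shadowed (predecessors U).
Proof.
move=> hU b pb.
have /choice[g Hg] : forall i, exists g, U (T g) /\
    followers U (g^-1 * ((b (i + 1)%R)^-1 * T (b i))).
  move=> i; have [m [_ [Bm [w [u [Uw Uu ->]]] ->]]] := pb i.
  exists (m * w * m^-1); split.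
    have := normal_fwd nU m^-1 Uw; by rewrite /= invgK.
  rewrite !invgM !invgK !mulgA !mulgVK.
  apply: (sgM sg_followers); last exact: followers_sub.
  by rewrite -(bwdK T m); exact: predecessors_followers.
have [i|y Hy] := hU (fun i => b i * g (i - 1)%R).
  rewrite addrK invgM fwdM -mulgA mulgA.
  have -> : (g i)^-1 * (b (i + 1)%R)^-1 * (T (b i) * T (g (i - 1)%R)) =
    (g i)^-1 * ((b (i + 1)%R)^-1 * T (b i)) * T (g (i - 1)%R) by rewrite !mulgA.
  apply: (sgM sg_followers); first exact: (Hg i).2.
  by apply: followers_sub; exact: (Hg (i - 1)%R).1.
exists y => i; have := Hy i; rewrite invgM -mulgA => Uy.
exists (g (i - 1)%R), ((g (i - 1)%R)^-1 * ((b i)^-1 * tau i y)); split => //.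
  exact: (Hg _).1.
by rewrite mulVKg.
Qed.

Lemma sg_free_symbols : subgroup_set (free_symbols U).
Proof. by apply: sgI; [exact: sg_followers|exact: sg_predecessors]. Qed.

Lemma followers_free_symbols : followers (free_symbols U) `<=` followers U.
Proof.
move=> _ [m [n [[_ Bm] [An _] ->]]]; apply: (sgM sg_followers) => //.
by rewrite -(bwdK T m); exact: predecessors_followers.
Qed.

Lemma shadowed_free_symbols : shadowed U -> shadowed (free_symbols U).
Proof.
move=> hU b pb; have [i|y Hy] := hU b; first exact: followers_free_symbols.
by exists y => i; split; [apply: followers_sub|apply: predecessors_sub].
Qed.

(* With H = free_symbols U, a symbol x U splits into x H and its position in
   x H; any symbol in x H may be followed by any symbol in T(x) H, so the
   sequence of positions is arbitrary. *)
Lemma code_extension (A : finType) (phi : G -> A) :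
  open U -> shadowed U -> full_shift_code (free_symbols U) phi ->
  exists (A' : finType) (phi' : G -> A'), full_shift_code U phi'.
Proof.
move=> oU hU [phiH phi_inj phi_surj].
set H := free_symbols U; have sH : subgroup_set H := sg_free_symbols.
have UH : U `<=` H.
  by move=> x Ux; split; [exact: followers_sub|exact: predecessors_sub].
have [l Hl] := finite_cosets cG oU sU.
have [r [rU rE]] := coset_representatives sU.
have [s [sHs sE]] := coset_representatives sH.
(* The position of [x] in its [H]-coset is [r ((s x)^-1 * x)]; [lH] lists its possible values. *)
pose lH := [seq r z | z <- l & `[< H z >]].
have lHP v : v \in lH -> H v /\ r v = v.
  move=> /mapP[z]; rewrite mem_filter => /andP[/asboolP Hz _] ->.
  split; last by rewrite -(rE _ _ (rU z)).
  by rewrite -(mulVKg z (r z)); apply: (sgM sH) => //; exact: UH.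
have mem x : r ((s x)^-1 * x) \in lH.
  have [z zl Uz] := Hl ((s x)^-1 * x).
  apply/mapP; exists z; last by rewrite (rE _ _ Uz).
  rewrite mem_filter zl andbT; apply/asboolP.
  have Hsx : H ((s x)^-1 * x) by exact: (sg_sym sH).
  rewrite -[z](mulVKg ((s x)^-1 * x)); apply: (sgM sH) => //.
  by apply: UH; exact: sg_sym.
exists (A * seq_sub lH)%type, (fun x => (phi x, SeqSub (mem x))); split.
- move=> x u Uu; rewrite phiH; last exact: UH.
  congr pair; apply: val_inj => /=.
  rewrite -(sE x (x * u)); last by rewrite mulKg; exact: UH.
  by apply/esym/rE; rewrite coset_mull mulKg.
- move=> x y xy i.
  have Hxy : forall i, H (tau i (x^-1 * y)).
    by apply: phi_inj => j; have /(congr1 fst) := xy j.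
  have /(congr1 snd)/(congr1 val) /= := xy i.
  have -> : s (tau i y) = s (tau i x).
    by apply/esym/sE; rewrite -iterzV -iterzM.
  move=> rxy; have := rU ((s (tau i x))^-1 * tau i x); rewrite rxy.
  move=> /sg_trans-/(_ sU _ (sg_sym sU (rU _))).
  by rewrite coset_mull -iterzV -iterzM.
- move=> a; have [x Hx] := phi_surj (fun i => (a i).1).
  pose v i := val (a i).2.
  have Hv i : H (v i) /\ r (v i) = v i by exact: lHP (valP (a i).2).
  (* The prescribed positions are placed in the [H]-cosets of the orbit of [x]. *)
  pose b i := s (tau i x) * v i.
  have Hb i : H ((tau i x)^-1 * b i).
    by rewrite mulgA; apply: (sgM sH) => //; exact: (Hv i).1.
  have [i|y Hy] := hU b.
    rewrite (_ : _ * T (b i) = ((tau (i + 1)%R x)^-1 * b (i + 1)%R)^-1 *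
        T ((tau i x)^-1 * b i)).
      apply: (sgM sg_followers); first exact: (sgV sg_followers (Hb _).1).
      exact: predecessors_followers (Hb i).2.
    by rewrite [T (_^-1 * _)]fwdM fwdV -iterzS coset_mull.
  exists y => i.
  have Hxy : H ((tau i x)^-1 * tau i y).
    by apply: (sg_trans sH (Hb i)); exact: UH.
  rewrite [a i]surjective_pairing; congr pair.
    by rewrite -(mulVKg (tau i x) (tau i y)) phiH.
  apply: val_inj => /=; rewrite -(sE _ _ Hxy) -[RHS](Hv i).2.
  apply/esym/rE; have := Hy i.
  by rewrite /b invgM mulgA.
Qed.

(* When no symbol is free, a symbol is determined by its coset modulo
   predecessors U together with the preceding one. *)
Lemma code_amalgamation (A : finType) (phi : G -> A) :
  free_symbols U `<=` U -> full_shift_code (predecessors U) phi ->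
  full_shift_code U phi.
Proof.
move=> HU [phiB phi_inj phi_surj]; split => //.
  by move=> x u Uu; apply: phiB; exact: predecessors_sub.
(* Each [T^i(x^-1 y)] is in [predecessors U]; as the image of the one at [i - 1] it is also in
   [followers U]. *)
move=> x y xy i; apply: HU; split; last exact: phi_inj.
rewrite -[i](subrK 1%R) iterzS; apply: predecessors_followers.
exact: phi_inj.
Qed.

(** An orbit in [U] at time [m] was in [U] at all earlier times, so confinement holds with both sets
    equal to [U]. *)
Lemma invariant_full : open U -> (forall x, U (T x) -> U x) -> U = setT.
Proof.
move=> oU invU; apply: (transitive_confinement hG trT oU).
- exact: sU.1.
- exact: open_subgroup_closed.
move=> x m k km _ Um.
rewrite -(subnK km) in Um; elim: (m - k)%N Um => // n IH.
by rewrite addSn -addn1 PoszD iterzS => /invU.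
Qed.

End one_subgroup.

Theorem full_shift_code_exists U :
  open U -> subgroup_set U -> normal_set U -> shadowed U ->
  exists (A : finType) (phi : G -> A), full_shift_code U phi.
Proof.
move=> oU0 sU0 nU0 hU0.
have [l Hl] := finite_cosets cG oU0 sU0.
(* The measure counts the listed representatives of [U]-cosets outside [V]; [U] stays fixed, and
   each strict enlargement of [V] catches at least one more. *)
suff main (n : nat) : forall V : set G, U `<=` V -> subgroup_set V ->
    normal_set V -> shadowed V ->
    (size l - count (fun x => `[< V x >]) l < n)%N ->
    exists (A : finType) (phi : G -> A), full_shift_code V phi.
  by apply: (main _ U) => //; exact: ltnSn.
have grow (V W : set G) x : U `<=` V -> subgroup_set V -> subgroup_set W ->
    V `<=` W -> W x -> ~ V x ->
    (count (fun x => `[< V x >]) l < count (fun x => `[< W x >]) l)%N.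
  move=> UV sV sW VW Wx nVx; have [z zl Uzx] := Hl x.
  apply: (count_lt _ zl).
  - by move=> y /asboolP/VW Wy; apply/asboolP.
  - apply/asboolPn => Vz; apply: nVx.
    by rewrite -(mulVKg z x); apply: (sgM sV) => //; exact: UV.
  - apply/asboolP; rewrite -(mulVKg x z); apply: (sgM sW) => //.
    by apply: VW; apply: UV; exact: sg_sym.
have measure (V W : set G) k x : U `<=` V -> subgroup_set V -> subgroup_set W ->
    V `<=` W -> W x -> ~ V x ->
    (size l - count (fun x => `[< V x >]) l < k.+1)%N ->
    (size l - count (fun x => `[< W x >]) l < k)%N.
  move=> UV sV sW VW Wx nVx; have := grow V W x UV sV sW VW Wx nVx.
  have := count_size (fun x => `[< W x >]) l; lia.
elim: n => [//|n IH] V UV sV nV hV Vn.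
have oV : open V by exact: open_supergroup UV.
have [HV|] := pselect (free_symbols V `<=` V); last first.
  move=> /existsNP[x /not_implyP[Hx nVx]].
  have VH : V `<=` free_symbols V.
    by move=> y Vy; split; [exact: followers_sub|exact: predecessors_sub].
  have sH := sg_free_symbols sV nV.
  have [|||||A [phi phiP]] := IH (free_symbols V).
  - exact: subset_trans VH.
  - exact: sH.
  - move=> g y [Ay By]; split; first exact: normal_followers.
    exact: normal_predecessors.
  - exact: shadowed_free_symbols.
  - exact: (measure V _ n x).
  exact: (code_extension sV nV oV hV phiP).
have [BV|] := pselect (predecessors V `<=` V); last first.
  move=> /existsNP[x /not_implyP[Bx nVx]].
  have VB := @predecessors_sub V sV.
  have [|||||A [phi phiP]] := IH (predecessors V).
  - exact: subset_trans VB.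
  - exact: sg_predecessors.
  - exact: normal_predecessors.
  - exact: shadowed_predecessors.
  - exact: (measure V _ n x (UV) sV (sg_predecessors sV nV)).
  by exists A, phi; exact: code_amalgamation phiP.
have VT : V = setT.
  by apply: invariant_full => // x VTx; apply: BV; exact: (sub_mul_setl sV).
exists unit, (fun=> tt); split => // [x y _ i|a]; first by rewrite VT.
by exists 1 => i; case: (a i).
Qed.

End full_shift_coding.

(** * Bases of open subgroups *)

Section compact_spaces.

(** Otherwise compactness gives a point of [A] in the closure of every neighbourhood of [b], and in
    a Hausdorff space this point is [b]. *)
Lemma hausdorff_separate_point (X : topologicalType) (A : set X) (b : X) :
  hausdorff_space X -> compact A -> ~ A b ->
  exists2 N, nbhs b N & A `&` closure N = set0.
Proof.
move=> hX cA nAb; apply: contrapT => /forall2NP nN.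
have [|_ _ [M Mb <-] [N Nb <-]|_ [M Mb <-]|_ [M Mb <-]|a Aa Na] :=
    @compact_directed _ A [set closure N | N in nbhs b] cA.
- by exists (closure setT), setT => //; exact: filterT.
- exists (closure (M `&` N)); first by exists (M `&` N) => //; exact: filterI.
  by move=> x Mx; split; apply: closureS Mx => y [].
- exact: closed_closure.
- by apply/set0P/eqP; case: (nN M) => // /(_ Mb).
apply: nAb; rewrite (_ : b = a) //; apply: hX; rewrite clusterE => N Nb.
by apply: Na; exists N.
Qed.

Lemma hausdorff_separate (X : topologicalType) (A B : set X) :
  hausdorff_space X -> compact A -> compact B -> A `&` B = set0 ->
  exists P Q, [/\ open P, open Q, A `<=` P, B `<=` Q & P `&` Q = set0].
Proof.
move=> hX cA cB AB0.
suff [M [oM AM MB]] : exists M, [/\ open M, A `<=` M & B `&` closure M = set0].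
  exists M, (~` closure M); split => //.
  - exact/closed_openC/closed_closure.
  - by move=> x Bx Mx; rewrite -[False]/(set0 x) -MB.
  - rewrite -subset0 => x [Mx]; apply; exact: subset_closure.
apply: contrapT => nM.
have [|_ _ [M [oM AM] <-] [N [oN AN] <-]|_ [M _ <-]|_ [M [oM AM] <-]|b Bb Mb] :=
    @compact_directed _ B
      [set closure M | M in [set M | open M /\ A `<=` M]] cB.
- by exists (closure setT), setT => //; split => //; exact: openT.
- exists (closure (M `&` N)).
    exists (M `&` N) => //; split; first exact: openI.
    by move=> x Ax; split; [exact: AM|exact: AN].
  by move=> x Mx; split; apply: closureS Mx => y [].
- exact: closed_closure.
- by apply/set0P/eqP => BM; apply: nM; exists M.
have nAb : ~ A b by move=> Ab; rewrite -[False]/(set0 b) -AB0.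
have [N Nb AN] := hausdorff_separate_point hX cA nAb.
have clNb : closure (~` closure N) b.
  apply: Mb; exists (~` closure N) => //; split.
    exact/closed_openC/closed_closure.
  by move=> x Ax Nx; rewrite -[False]/(set0 x) -AN.
have [x [nNx Nx]] := clNb _ Nb; apply: nNx; exact: subset_closure.
Qed.

(* In a compact set the intersection of the relatively clopen sets containing x
   is connected. *)
Lemma totally_disconnected_clopen_basis (X : topologicalType) (K V : set X)
    (x : X) :
  hausdorff_space X -> totally_disconnected [set: X] -> compact K ->
  open V -> V x -> V `<=` K ->
  exists W, [/\ open W, compact W, W x & W `<=` V].
Proof.
move=> hX tdX cK oV Vx VK; have clK := compact_closed hX cK.
pose F := [set C | [/\ closed C, C x & exists2 O, open O & C = K `&` O]].
have FK : F K.
  by split => //; [exact: VK|exists setT; [exact: openT|rewrite setIT]].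
have FI A B : F A -> F B -> F (A `&` B).
  move=> [clA Ax [ O oO AO]] [clB Bx [P oP BP]]; split; first exact: closedI.
    by [].
  by exists (O `&` P); [exact: openI|rewrite AO BP setIACA setIid].
have inside O : open O -> (forall y, (forall C, F C -> C y) -> O y) ->
    exists2 C, F C & C `<=` O.
  move=> oO QO; apply: contrapT => /forall2NP nO.
  have [|_ _ [A FA <-] [B FB <-]|_ [A [clA _ _] <-]|_ [A FA <-]|y Ky Qy] :=
      @compact_directed _ K [set C `&` ~` O | C in F] cK.
  - by exists (K `&` ~` O), K.
  - exists (A `&` B `&` ~` O); first by exists (A `&` B) => //; exact: FI.
    by move=> y [[Ay By] nOy].
  - by apply: closedI => //; exact: open_closedC.
  - have [//|/existsNP[y /not_implyP[Ay nOy]]] := nO A.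
    exists y; split => //; case: FA => _ _ [P _ AP].
    by move: Ay; rewrite AP => -[].
  have [_] : (K `&` ~` O) y by apply: Qy; exists K.
  by apply; apply: QO => C FC; have [] : (C `&` ~` O) y by apply: Qy; exists C.
pose Q := [set y | forall C, F C -> C y].
have Qx : Q x by move=> C [].
have clQ : closed Q.
  rewrite (_ : Q = \bigcap_(C in F) C).
    by apply: closed_bigI => C [].
  by apply/seteqP; split => y Qy C FC; exact: Qy.
have cQ : compact Q by apply: subclosed_compact cK _ => // y; apply.
(* Some [C] in [F] is already covered by [P] and [P']; its part in [P] equals its part outside [P'],
   hence is again in [F]. *)
have side P P' : open P -> open P' -> P `&` P' = set0 -> P x ->
    Q `<=` P `|` P' -> Q `<=` P.
  move=> oP oP' PP' Px QP.
  have [C FC CP] := inside (P `|` P') (openU oP oP') QP.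
  have CP' : C `&` P = C `&` ~` P'.
    apply/seteqP; split => y [Cy]; split => //.
      by move=> P'y; rewrite -[False]/(set0 y) -PP'.
    by have [] := CP _ Cy.
  suff FCP : F (C `&` P) by move=> y /(_ _ FCP)[].
  case: FC => clC Cx [ O oO CO]; split => //.
    by rewrite CP'; apply: closedI => //; exact: open_closedC.
  by exists (O `&` P); [exact: openI|rewrite CO setIA].
(* A relatively clopen part of [Q] and its complement are disjoint compact sets; open sets
   separating them fall under [side], according to which contains [x]. *)
have conQ : connected Q.
  move=> B [b Bb] [C oC BC] [D clD BD]; apply: contrapT => BQ.
  have clB : closed B by rewrite BD; exact: closedI.
  have clB' : closed (Q `&` ~` C) by apply: closedI => //; exact: open_closedC.
  have cB : compact B.
    by apply: subclosed_compact cQ _ => //; rewrite BC => y [].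
  have cB' : compact (Q `&` ~` C) by apply: subclosed_compact cQ _ => // y [].
  have [|P [P' [oP oP' BP BP' PP']]] := hausdorff_separate hX cB cB'.
    by rewrite -subset0 => y []; rewrite BC => -[_ Cy] [_].
  have QP : Q `<=` P `|` P'.
    move=> y Qy; have [Cy|nCy] := pselect (C y).
      by left; apply: BP; rewrite BC.
    by right; apply: BP'.
  have [Px|P'x] := QP _ Qx.
    apply: BQ; rewrite BC; apply/setIidPl => y Qy; apply: contrapT => nCy.
    rewrite -[False]/(set0 y) -PP'; split; last exact: BP'.
    exact: (side P P').
  have Qb : Q b by move: Bb; rewrite BC => -[].
  rewrite -[False]/(set0 b) -PP'; split; first exact: BP.
  apply: (side P' P) => //; first by rewrite setIC.
  by move=> y /QP[]; [right|left].
(* Total disconnectedness reduces [Q] to [{x}]. The resulting [C] is open because it lies in [V],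
   where [K] imposes no condition. *)
have [C [clC Cx [ O oO CO]] CV] : exists2 C, F C & C `<=` V.
  apply: inside => // y Qy; suff -> : y = x by [].
  rewrite -[y = x]/([set x] y) -(tdX x) //.
  by exists Q.
exists C; split => //; last first.
  by apply: subclosed_compact cK _ => // y; rewrite CO => -[].
rewrite (_ : C = V `&` O); first exact: openI.
apply/seteqP; split => y.
  by move=> Cy; split; [exact: CV|move: Cy; rewrite CO => -[]].
by move=> [Vy Oy]; rewrite CO; split => //; exact: VK.
Qed.

(** The tube lemma. *)
Lemma compact_forall_open (X Y : topologicalType) (K : set X)
    (O : set (X * Y)) :
  compact K -> open O -> open [set y | forall x, K x -> O (x, y)].
Proof.
move=> /compact_near_coveringP ncK oO; rewrite openE => y Ky.
apply: (ncK Y (nbhs y) (fun z x => O (x, z))) => x Kx.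
have [[A B] AB ABO] : nbhs (x, y) O.
  by apply: open_nbhs_nbhs; split => //; exact: Ky.
by exists (A, B) => // -[a b] /ABO.
Qed.

(** A continuous surjection from a compact space to a Hausdorff space is closed, hence a quotient
    map. *)
Lemma continuous_quotient (X Y Z : topologicalType) (f : X -> Y) (g : Y -> Z) :
  compact [set: X] -> hausdorff_space Y -> continuous f ->
  (forall y, exists x, f x = y) -> continuous (g \o f) -> continuous g.
Proof.
move=> cX hY cf sf cgf; apply/continuousP => A oA.
rewrite -[g @^-1` A]setCK; apply: closed_openC.
rewrite (_ : ~` _ = f @` ((g \o f) @^-1` (~` A))).
  apply: (compact_closed hY); apply: continuous_compact.
    exact: continuous_subspaceT.
  apply: (subclosed_compact _ cX) => //.
  by apply: closed_comp; [move=> x _; exact: cgf|exact: open_closedC].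
apply/seteqP; split => [y nAy|_ [x nAx <-] //].
by have [x xy] := sf y; exists x => //=; rewrite xy.
Qed.

Lemma hausdorff_injective (X Y : topologicalType) (f : X -> Y) :
  continuous f -> injective f -> hausdorff_space Y -> hausdorff_space X.
Proof.
move=> cf injf hY p q pq; apply/injf/hY => A B pA qB.
have [|y [Ay By]] := pq (f @^-1` A) (f @^-1` B) _ (cf q _ qB); first exact: cf.
by exists (f y).
Qed.

Lemma continuous_prod_topology (X : topologicalType) (I : Type)
    (K : I -> topologicalType) (f : X -> prod_topology K) :
  (forall i, continuous (fun x => f x i)) -> continuous f.
Proof.
move=> cf x; apply/cvg_sup => i U /= [_ [[W oW <-] /= Wfx] sWU].
by apply: filterS sWU _; apply: cf; exact: open_nbhs_nbhs.
Qed.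

Lemma prod_topology_hausdorff (I : eqType) (K : I -> topologicalType) :
  (forall i, hausdorff_space (K i)) -> hausdorff_space (prod_topology K).
Proof. exact: hausdorff_product. Qed.

Lemma full_shift_hausdorff (A : finType) : hausdorff_space (full_shift A).
Proof. by apply: prod_topology_hausdorff => _; exact: discrete_hausdorff. Qed.

End compact_spaces.

(** * Small open subgroups *)

Section open_subgroup_basis.
Variable G : topologicalGroupType.
Hypotheses (hG : hausdorff_space G) (tdG : totally_disconnected [set: G]).

(** Van Dantzig's theorem. For [W] compact open around 1, the set [S] of [g] with [W g] inside [W]
    is open by the tube lemma, and [S] cut with its inverse is a subgroup inside [W]. *)
Lemma open_subgroup_basis (V : set G) :
  locally_compact [set: G] -> open V -> V 1 ->
  exists U, [/\ open U, compact U, subgroup_set U & U `<=` V].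
Proof.
move=> /(_ 1 I)[K /= withinK [cK _]] oV V1.
have K1 : nbhs 1 K.
  by move: withinK; rewrite /within /=; apply: filterS => x; apply.
have [|||W [oW cW W1 WV]] := @totally_disconnected_clopen_basis _ K
  (V `&` interior K) 1 hG tdG cK.
- by apply: openI => //; exact: open_interior.
- by split.
- by move=> x [_ /interior_subset].
pose S := [set g | forall w, W w -> W (w * g)].
have oS : open S.
  apply: (@compact_forall_open G G W [set z | W (z.1 * z.2)] cW).
  by apply: open_comp oW => z _; exact: mulg_continuous.
have oU : open (S `&` [set g | S g^-1]).
  by apply: openI => //; apply: open_comp oS => z _; exact: invg_continuous.
have sU : subgroup_set (S `&` [set g | S g^-1]).
  split; first by split => w /=; rewrite ?invg1 mulg1.
  move=> x y [Sx Sx'] [Sy Sy']; split => w Ww /=.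
    by rewrite mulgA; apply: Sy; exact: Sx'.
  by rewrite invgM invgK mulgA; apply: Sx; exact: Sy'.
have UW : S `&` [set g | S g^-1] `<=` W.
  by move=> g [Sg _]; rewrite -[g]mul1g; exact: Sg.
exists (S `&` [set g | S g^-1]); split => //.
- by apply: subclosed_compact cW UW; exact: open_subgroup_closed.
- by move=> g /UW/WV[].
Qed.

Hypothesis cG : compact [set: G].

(** The intersection [N] of all conjugates of [U] is open by the tube lemma over the compact
    group. *)
Lemma open_normal_subgroup_basis (V : set G) : open V -> V 1 ->
  exists U, [/\ open U, subgroup_set U, normal_set U & U `<=` V].
Proof.
move=> oV V1.
have lcG : locally_compact [set: G].
  move=> x _; exists setT; first exact: filterT.
  by split => //; exact: closedT.
have [U [oU _ sU UV]] := open_subgroup_basis lcG oV V1.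
pose N := [set g | forall x, [set: G] x -> U (x^-1 * g * x)].
exists N; split.
- apply: (@compact_forall_open G G setT [set z | U (z.1^-1 * z.2 * z.1)] cG).
  apply: open_comp oU => z _; apply: continuous_mulg.
    apply: continuous_mulg; last by move=> w; exact: cvg_snd.
    by apply: continuous_invg => w; exact: cvg_fst.
  by move=> w; exact: cvg_fst.
- split => [x _|x y Nx Ny z _]; first by rewrite mulg1 mulVg; exact: sU.1.
  have -> : z^-1 * (x^-1 * y) * z = (z^-1 * x * z)^-1 * (z^-1 * y * z).
    by rewrite !invgM invgK !mulgA mulgK.
  by apply: sU.2; [exact: Nx|exact: Ny].
- move=> g x Nx z _.
  have -> : z^-1 * (g^-1 * x * g) * z = (g * z)^-1 * x * (g * z).
    by rewrite invgM !mulgA.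
  exact: Nx.
- by move=> g /(_ 1 I); rewrite invg1 mul1g mulg1 => /UV.
Qed.

Lemma shadowed_basis (T : topAut G) (V : set G) : open V -> V 1 ->
  exists U, [/\ open U, subgroup_set U, normal_set U, shadowed T U & U `<=` V].
Proof.
move=> oV V1; have [U [oU sU nU UV]] := open_normal_subgroup_basis oV V1.
have cl (W : set G) : open W -> subgroup_set W -> compact W.
  move=> oW sW; apply: (subclosed_compact _ cG) => //.
  exact: open_subgroup_closed.
have [N fN] := factorizing_truncation T oU (cl _ oU sU) sU.
have oN := open_truncated_plus_part T N oU.
have sN := sg_truncated_plus_part T N sU.
have nN : normal_set (truncated_plus_part T U N).
  by move=> g x Ux k kN; rewrite !iterzM iterzV; apply: nU; exact: Ux.
exists (truncated_plus_part T U N); split => //.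
  by apply: factorizing_shadowed => //; [exact: open_subgroup_closed|exact: cl].
by move=> x /(_ 0%N)/(_ isT)/UV.
Qed.

End open_subgroup_basis.

(** * Inverse limits *)

Section shadowed_chain.
Variable G : topologicalGroupType.
Hypotheses (hG : hausdorff_space G) (scG : @second_countable G).

Lemma countable_separating_opens : exists V : nat -> set G,
  (forall n, open (V n) /\ V n 1) /\ forall x, (forall n, V n x) -> x = 1.
Proof.
case: scG => B /countable_injP[f injf] [oB nB].
(* The basic set numbered [n] if it exists and contains 1, the whole group otherwise. *)
exists (fun n => [set x | forall U, B U -> U 1 -> f U = n -> U x]).
split=> [n|x Vx]; last first.
  apply: contrapT => x1; move: (hG); rewrite open_hausdorff => /(_ 1 x).
  case=> [|[P Q] /= [P1 Qx] [oP _ PQ0]]; first by apply/eqP => /esym.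
  have [|U [BU U1] UP] := nB 1 P.
    by apply: open_nbhs_nbhs; split => //; rewrite inE in P1.
  have : (P `&` Q) x.
    split; last by rewrite inE in Qx.
    by apply: UP; exact: (Vx (f U)).
  by move/eqP: PQ0 => ->.
split; last by [].
have [[U0 [BU0 U01 fU0]]|nU] := pselect (exists U, [/\ B U, U 1 & f U = n]).
  rewrite (_ : mkset _ = U0); first exact: oB.
  apply/seteqP; split => x; first by apply.
  by move=> Ux U BU U1 fU; rewrite (injf U U0) ?inE // fU.
rewrite (_ : mkset _ = setT); first exact: openT.
by apply/seteqP; split => // x _ U BU U1 fU; exfalso; apply: nU; exists U.
Qed.

Lemma shadowed_chain (T : topAut G) :
  totally_disconnected [set: G] -> compact [set: G] ->
  exists U : nat -> set G,
    [/\ forall n, [/\ open (U n), subgroup_set (U n), normal_set (U n) &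
          shadowed T (U n)],
        forall n, U n.+1 `<=` U n &
        forall x, (forall n, U n x) -> x = 1].
Proof.
move=> tdG cG; have [V [oV V1]] := countable_separating_opens.
have /choice[F HF] : forall W : set G, exists U, open W -> W 1 ->
    [/\ open U, subgroup_set U, normal_set U, shadowed T U & U `<=` W].
  move=> W; have [[oW W1]|nW] := pselect (open W /\ W 1).
    by have [U HU] := shadowed_basis hG tdG cG T oW W1; exists U.
  by exists setT => oW W1; exfalso; apply: nW.
pose U := fix U n := if n is m.+1 then F (U m `&` V m.+1) else F (V 0%N).
have HU n : [/\ open (U n), subgroup_set (U n), normal_set (U n) &
    shadowed T (U n)] /\ U n `<=` V n.
  elim: n => [|n [[oU sU nU hU] UV]].
    by have [] := HF _ (oV 0%N).1 (oV 0%N).2.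
  have [] // := HF (U n `&` V n.+1).
  - by apply: openI => //; exact: (oV _).1.
  - by split; [exact: sU.1|exact: (oV _).2].
  by move=> oU' sU' nU' hU' sub; split => // x /sub[].
exists U; split.
- by move=> n; exact: (HU n).1.
- move=> n; have [[oU sU nU hU] UV] := HU n.
  have [] // := HF (U n `&` V n.+1).
  - by apply: openI => //; exact: (oV _).1.
  - by split; [exact: sU.1|exact: (oV _).2].
  by move=> _ _ _ _ sub x /sub[].
- by move=> x Ux; apply: V1 => n; exact: (HU n).2.
Qed.

End shadowed_chain.

(** * From the codes of a chain to an inverse limit *)

Section inverse_limit_of_codes.
Variables (G : topologicalGroupType) (T : topAut G).
Hypotheses (hG : hausdorff_space G) (cG : compact [set: G]).
Variables (U : nat -> set G) (A : nat -> finType) (phi : forall n, G -> A n).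
Hypotheses (oU : forall n, open (U n)) (sU : forall n, subgroup_set (U n))
  (decU : forall n, U n.+1 `<=` U n)
  (capU : forall x, (forall n, U n x) -> x = 1)
  (phiP : forall n, full_shift_code T (U n) (phi n)).
Local Notation tau := (iterz T).

Let c (n : nat) (x : G) : full_shift (A n) := fun i => phi n (tau i x).

Let c_continuous n : continuous (c n).
Proof.
apply: continuous_prod_topology => i x.
apply: (@near_cst_continuous _ (discrete_topology (A n)) (phi n (tau i x))).
have [phiU _ _] := phiP n.
have oW : open [set y | U n ((tau i x)^-1 * tau i y)].
  apply: (@open_comp _ _ (fun y => (tau i x)^-1 * tau i y)) (oU n) => y _.
  apply: (@cvg_comp _ _ _ (tau i) (fun y => (tau i x)^-1 * y)).
    exact: iterz_continuous.
  exact: continuous_mulgl.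
apply: filterS (open_nbhs_nbhs (conj oW _)) => [y /= Uy|] /=.
  by rewrite /c -(mulVKg (tau i x) (tau i y)) phiU.
by rewrite mulVg; exact: (sU n).1.
Qed.

Let c_surj n y : exists x, c n x = y.
Proof.
have [_ _ phi_surj] := phiP n; have [x Hx] := phi_surj y.
by exists x; apply/funext => i; exact: Hx.
Qed.

Let c_shift n x : c n (T x) = shift_map (c n x).
Proof. by apply/funext => i; rewrite /c /shift_map iterzSr iterzS. Qed.

Let c_inj n x y : c n x = c n y -> forall i, U n (tau i (x^-1 * y)).
Proof.
move=> cxy; have [_ phi_inj _] := phiP n; apply: phi_inj => i.
exact: (congr1 (fun a => a i) cxy).
Qed.

Let c_dec n x y : c n.+1 x = c n.+1 y -> c n x = c n y.
Proof.
move=> cxy; apply/funext => i; rewrite /c.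
have [phiU _ _] := phiP n.
rewrite -(mulVKg x y) iterzM phiU //.
by apply: decU; exact: (c_inj cxy).
Qed.

Let lift n (y : full_shift (A n)) : G := sval (cid (c_surj y)).
Let liftK n (y : full_shift (A n)) : c n (lift y) = y.
Proof. exact: (svalP (cid (c_surj y))). Qed.

(** By [c_dec] the result does not depend on the chosen preimage: this is the map induced by the
    identity of [G]. *)
Let bnd n (y : full_shift (A n.+1)) : full_shift (A n) := c n (lift y).

Let bnd_c n x : bnd (c n.+1 x) = c n x.
Proof. by apply: c_dec; rewrite liftK. Qed.

Let bnd_continuous n : continuous (@bnd n).
Proof.
apply: (continuous_quotient cG (@full_shift_hausdorff _) (@c_continuous n.+1)
  (@c_surj n.+1)).
rewrite (_ : _ \o _ = c n); first exact: c_continuous.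
by apply/funext => x /=; rewrite bnd_c.
Qed.

Let bnd_surj n : set_surj setT setT (@bnd n).
Proof.
move=> y _; have [x <-] := c_surj y.
by exists (c n.+1 x) => //; rewrite bnd_c.
Qed.

Let bnd_shift n (y : full_shift (A n.+1)) :
  bnd (shift_map y) = shift_map (bnd y).
Proof.
by have [x <-] := c_surj y; rewrite -c_shift !bnd_c c_shift.
Qed.

Let S : full_shift_system :=
  Build_full_shift_system bnd_continuous bnd_surj bnd_shift.

Lemma codes_conjugate : exists S : full_shift_system,
  topologically_conjugate T (limit_shift S).
Proof.
exists S.
have cS x : inverse_limit S (fun n => c n x) by move=> n; exact: bnd_c.
pose h (x : G) : set_type (inverse_limit S) := SigSub (mem_set (cS x)).
have cprod : continuous ((fun x n => c n x) :
    G -> prod_topology (fun n => full_shift (alphabet S n))).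
  by apply: continuous_prod_topology => n; exact: c_continuous.
have ch : continuous h.
  by apply: (@continuous_comp_initial _ _ _ set_val).
have injh : injective h.
  move=> x y /(congr1 set_val) /= hxy; apply/esym/(mulgI x^-1); rewrite mulVg.
  apply: capU => n.
  have cxy : c n x = c n y by exact: (f_equal (fun a => a n) hxy).
  exact: (c_inj cxy 0%R).
have hh : hausdorff_space (set_type (inverse_limit S)).
  apply: (@hausdorff_injective _ _ set_val); first exact: initial_continuous.
    exact: val_inj.
  by apply: prod_topology_hausdorff => n; exact: full_shift_hausdorff.
have surjh : forall y, exists x, h x = y.
  move=> y; have yS : inverse_limit S (set_val y) by exact: set_valP.
  (* The fibres of [c n] over the coordinates of [y] are closed and nonempty, and they decrease
     because [y] respects the bonding maps. *)
  have [|n x cx|n|x _ Hx] := @compact_nested _ _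
      (fun n => [set x | c n x = set_val y n]) cG.
  - move=> n; rewrite (_ : mkset _ = c n @^-1` [set set_val y n]) //.
    apply: closed_comp; first by move=> x _; exact: c_continuous.
    apply: accessible_closed_set1; apply: hausdorff_accessible.
    exact: full_shift_hausdorff.
  - by move: cx => /= cx; rewrite -bnd_c cx; exact: yS.
  - by have [x xy] := c_surj (set_val y n); exists x.
  exists x; apply: val_inj => /=.
  by apply: functional_extensionality_dep => n; exact: Hx.
have bijh : bijective h.
  have /choice[k hk] := surjh.
  by exists k => // x; apply: injh; rewrite hk.
case: bijh => k hk kh; exists h; split.
  split => //; exists k; split => //.
  apply: (continuous_quotient cG hh ch surjh).
  rewrite (_ : _ \o _ = id) => [x|]; first exact: cvg_id.
  by apply/funext => x /=; rewrite hk.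
move=> x; apply: val_inj => /=.
by apply: functional_extensionality_dep => n; exact: c_shift.
Qed.

End inverse_limit_of_codes.

Theorem transitive_conjugate_inverse_limit (G : topologicalGroupType)
    (T : topAut G) :
  @second_countable G -> hausdorff_space G -> locally_compact [set: G] ->
  totally_disconnected [set: G] -> top_transitive T ->
  exists S : full_shift_system, topologically_conjugate T (limit_shift S).
Proof.
move=> scG hG lcG tdG trT.
have cG : compact [set: G].
  have [|U0 [oU0 cU0 sU0 _]] := open_subgroup_basis hG tdG lcG (@openT G).
    by [].
  have [N fN] := factorizing_truncation T oU0 cU0 sU0.
  apply: (transitive_compact hG _ _ _ fN trT).
  - exact: open_truncated_plus_part.
  - apply: (subclosed_compact _ cU0); last by move=> x /(_ 0%N)/(_ isT).
    apply: open_subgroup_closed; first exact: open_truncated_plus_part.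
    exact: sg_truncated_plus_part.
  - exact: sg_truncated_plus_part.
have [U [HU decU capU]] := shadowed_chain hG scG T tdG cG.
have code n : exists (A : finType) (phi : G -> A), full_shift_code T (U n) phi.
  by have [oU sU nU hU] := HU n; exact: full_shift_code_exists.
pose A n := sval (cid (code n)).
pose HA n := svalP (cid (code n)).
pose phi n : G -> A n := sval (cid (HA n)).
apply: (@codes_conjugate G T cG U A phi) => //.
- by move=> n; have [] := HU n.
- by move=> n; have [] := HU n.
- by move=> n; exact: (svalP (cid (HA n))).
Qed.

(** * Haar measure *)

Section haar_measure.
Variables (R : realType) (G : topologicalGroupType)
  (mu : {measure set (borelType G) -> \bar R}).
Hypotheses (scG : @second_countable G) (hG : hausdorff_space G)
  (haar_mu : is_haar_measure mu).

Lemma open_borel (O : set G) : open O -> measurable (O : set (borelType G)).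
Proof. by move=> oO; exact: (@sub_sigma_algebra G setT (@open G)). Qed.

Lemma closed_borel (C : set G) : closed C -> measurable (C : set (borelType G)).
Proof.
move=> cC; rewrite -[C]setCK.
apply: (@measurableC _ (borelType G)).
by apply: open_borel; exact: closed_openC.
Qed.

Lemma compact_borel (K : set G) :
  compact K -> measurable (K : set (borelType G)).
Proof. by move=> /(compact_closed hG); exact: closed_borel. Qed.

Lemma dense_sequence : exists p : nat -> G,
  forall O : set G, open O -> O !=set0 -> exists n, O (p n).
Proof.
case: scG => B /countable_injP[f injf] [oB nB].
have /choice[p Hp] : forall n, exists x : G, forall U, B U -> U !=set0 ->
    f U = n -> U x.
  move=> n; have [[U [BU U0 fU]]|nU] :=
      pselect (exists U, [/\ B U, U !=set0 & f U = n]).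
    case: U0 => x Ux; exists x => V BV _ fV.
    by rewrite (injf V U) ?inE // fU.
  by exists 1 => U BU U0 fU; exfalso; apply: nU; exists U.
exists p => O oO [x Ox]; have [|U [BU Ux] UO] := nB x O.
  by apply: open_nbhs_nbhs.
exists (f U); apply: UO; by apply: Hp => //; exists x.
Qed.

Let translate (g : G) (A : set G) : set (borelType G) := [set g * x | x in A].

(** If [A] were null, countably many translates, null by left invariance, would cover [G]. *)
Lemma haar_translates_neq0 (q : nat -> G) (A : set G) :
  measurable (A : set (borelType G)) ->
  (forall n, measurable (translate (q n) A)) ->
  (forall x, exists n, A ((q n)^-1 * x)) -> mu A <> 0%E.
Proof.
move=> mA mqA qA A0; apply: (haar_neq0 haar_mu).
have : mu.-negligible (\bigcup_n translate (q n) A).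
  apply: negligible_bigcup => n; exists (translate (q n) A); split => //.
  by rewrite -A0; exact: (haar_left_invariant haar_mu).
rewrite (_ : \bigcup_n _ = setT); last first.
  apply/seteqP; split => // x _; have [n Hn] := qA x.
  by exists n => //; exists ((q n)^-1 * x) => //; rewrite mulVKg.
case=> B [mB B0 TB]; apply: subset_measure0 B0 => //.
Qed.

Lemma translate_open g (O : set G) : open O -> open (translate g O : set G).
Proof.
move=> oO; rewrite (_ : translate g O = (fun x => g^-1 * x) @^-1` O).
  by apply: open_comp oO => x _; exact: continuous_mulgl.
apply/seteqP; split => x /=; first by move=> [y Oy <-]; rewrite mulKg.
by move=> Ox; exists (g^-1 * x) => //; rewrite mulVKg.
Qed.

Lemma translate_compact g (K : set G) :
  compact K -> compact (translate g K : set G).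
Proof.
move=> cK; apply: continuous_compact cK; apply: continuous_subspaceT.
exact: continuous_mulgl.
Qed.

Lemma haar_open_neq0 (O : set G) : open O -> O !=set0 -> mu O <> 0%E.
Proof.
move=> oO [ o Oo]; have [p Hp] := dense_sequence.
apply: (@haar_translates_neq0 p).
- exact: open_borel.
- by move=> n; apply: open_borel; exact: translate_open.
(* A dense sequence meets the nonempty open set [x O^-1], so [x] lies in some [p_n O]. *)
move=> x; apply: (Hp [set y | O (y^-1 * x)]).
  apply: (@open_comp _ _ (fun y => y^-1 * x)) oO => y _.
  apply: (@continuous_mulg G G (fun y => y^-1) (fun=> x)) => z.
    exact: invg_continuous.
  exact: cvg_cst.
by exists (x * o^-1); rewrite /= invgM invgK mulgVK.
Qed.

(* Outer regularity gives an open O containing H with mu O < 2 mu H; a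
   translate w H inside O cannot be disjoint from H. *)
Lemma haar_compact_subgroup_open (H : set G) :
  compact H -> subgroup_set H -> mu H <> 0%E -> open H.
Proof.
move=> cH sH H0; have mH := compact_borel cH.
have H_gt0 : (0 < mu H)%E by rewrite lt0e measure_ge0 andbT; apply/eqP.
have H_fin : mu H \is a fin_num.
  by rewrite ge0_fin_numE //; exact: (haar_compact haar_mu).
have [ O [oO HO] OH] : exists2 O : set G, open O /\ H `<=` O &
    (mu O < mu H + mu H)%E.
  have : (ereal_inf [set mu U | U in
      [set U : set G | open U /\ (H : set G) `<=` U]] < mu H + mu H)%E.
    by rewrite -(haar_outer_regular haar_mu mH) lteDl.
  by move=> /ereal_inf_lt[_ [ O [oO HO] <-] OH]; exists O.
pose W := [set w | forall h, H h -> O (w * h)].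
have oW : open W.
  apply: (@compact_forall_open G G H [set z | O (z.2 * z.1)] cH).
  apply: open_comp oO => z _; apply: continuous_mulg => y.
    exact: cvg_snd.
  exact: cvg_fst.
have WH : W `<=` H.
  move=> w Ww; apply: contrapT => nHw.
  have mwH : measurable (translate w H).
    by apply: compact_borel; exact: translate_compact.
  have dis : (H : set (borelType G)) `&` translate w H = set0.
    rewrite -subset0 => z [Hz [y Hy zE]]; apply: nHw.
    by rewrite -(mulgK y w) zE; apply: (sgM sH) => //; exact: sgV.
  have : (mu ((H : set (borelType G)) `|` translate w H) <= mu O)%E.
    apply: le_measure; rewrite ?inE.
    - exact: measurableU.
    - exact: open_borel.
    - by move=> x [/HO//|[y Hy <-]]; exact: Ww.
  rewrite (_ : mu _ = mu H + mu H)%E; first by rewrite leNgt OH.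
  rewrite measureU //; congr (_ + _)%E.
  exact: (haar_left_invariant haar_mu).
rewrite (_ : H = [set x | exists2 z, H z & W (z^-1 * x)]).
  exact: open_cosets.
apply/seteqP; split => x /=.
  by move=> Hx; exists x => // h Hh; rewrite mulVg mul1g; exact: HO.
by move=> [z Hz /WH Hzx]; rewrite -(mulVKg z x); exact: sgM.
Qed.

(** An open mapping theorem. For a compact open subgroup [U], translates of the compact subgroup
    [T U] by the image of a dense sequence cover [G], so [T U] is not null and hence open. *)
Lemma bijective_endomorphism_open (T S : G -> G) :
  locally_compact [set: G] -> totally_disconnected [set: G] ->
  {morph T : x y / x * y} -> cancel T S -> cancel S T ->
  continuous T -> continuous S.
Proof.
move=> lcG tdG TM TS ST cT.
have T1 : T 1 = 1 by apply: (mulgI (T 1)); rewrite -TM !mulg1.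
have TV x : T x^-1 = (T x)^-1.
  by apply: (mulgI (T x)); rewrite -TM !mulgV.
have SM x y : S (x * y) = S x * S y by apply: (can_inj TS); rewrite TM !ST.
have SV x : S x^-1 = (S x)^-1 by apply: (can_inj TS); rewrite TV !ST.
move=> x N; rewrite nbhsE => -[ O [oO OSx] ON].
have oxO : open [set y | O (S x * y)].
  by apply: open_comp oO => y _; exact: continuous_mulgl.
have [|U [oU cU sU UO]] := open_subgroup_basis hG tdG lcG oxO.
  by rewrite /= mulg1.
have SU : [set y | U (S y)] = T @` U.
  apply/seteqP; split => y; first by move=> Uy; exists (S y).
  by move=> [z Uz <-] /=; rewrite TS.
have cSU : compact [set y | U (S y)].
  by rewrite SU; apply: continuous_compact cU; exact: continuous_subspaceT.
have oSU : open [set y | U (S y)].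
  apply: haar_compact_subgroup_open => //.
    split=> /=; first by rewrite -T1 TS; exact: sU.1.
    by move=> y z Uy Uz; rewrite SM SV; exact: sU.2.
  have [p Hp] := dense_sequence.
  apply: (@haar_translates_neq0 (T \o p)).
  - exact: compact_borel.
  - by move=> n; apply: compact_borel; exact: translate_compact.
  move=> y; have [||n Un] := Hp [set z | U ((S y)^-1 * z)].
  - by apply: open_comp oU => z _; exact: continuous_mulgl.
  - by exists (S y); rewrite /= mulVg; exact: sU.1.
  by exists n; rewrite /= SM SV TS; exact: sg_sym.
have : open [set y | U (S (x^-1 * y))].
  by apply: (open_comp _ oSU) => y _; exact: continuous_mulgl.
move=> oxU; apply: (@filterS _ (nbhs x) _ [set y | U (S (x^-1 * y))]).
  move=> y Uy; apply: ON; have := UO _ Uy.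
  by rewrite /= SM SV mulVKg.
by apply: open_nbhs_nbhs; split => //=; rewrite mulVg -T1 TS; exact: sU.1.
Qed.

(** The union [A] of all iterates of [O] is open, invariant and not null, so its complement is null
    and cannot contain [V]. *)
Lemma ergodic_transitive (T : topAut G) :
  ergodic mu (T : borelType G -> borelType G) -> top_transitive T.
Proof.
move=> ergT O V oO oV O0 V0.
pose A : set G := [set x | exists i, O (iterz T i x)].
have oA : open A.
  rewrite (_ : A = \bigcup_(i in [set: int]) [set x | O (iterz T i x)]).
    by apply: bigcup_open => i _; exact: open_iterz.
  by apply/seteqP; split => x [i]; [exists i|move=> _ Oi; exists i].
have TA : T @^-1` A = A.
  apply/seteqP; split => x [i Oi].
    by exists (i + 1)%R; rewrite iterzS -iterzSr.
  by exists (i - 1)%R; rewrite iterzSr -iterzS subrK.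
have [|A0] := ergT A (open_borel oA) TA.
  move=> /haar_open_neq0; case=> //; case: O0 => x Ox; by exists x, 0%R.
have [x [Vx [i Oi]]] : V `&` A !=set0.
  apply/set0P/eqP => VA0; apply: (haar_open_neq0 oV V0).
  apply/eqP; rewrite eq_le measure_ge0 andbT -A0.
  apply: le_measure; rewrite ?inE.
  - exact: open_borel.
  - by apply: (@measurableC _ (borelType G)); exact: open_borel.
  - by move=> x Vx Ax; rewrite -[False]/((set0 : set G) x) -VA0.
by exists (- i)%R, (iterz T i x); rewrite iterzK.
Qed.

End haar_measure.

Theorem mainTheorem5 (R : realType) (G : topologicalGroupType)
    (second_countable_G : @second_countable G)
    (hausdorff_G : hausdorff_space G)
    (locally_compact_G : locally_compact [set: G])
    (totally_disconnected_G : totally_disconnected [set: G])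
    (T : {multiplicative G -> G})
    (bijective_T : bijective T)
    (continuous_T : continuous T)
    (mu : {measure set (borelType G) -> \bar R})
    (haar_mu : is_haar_measure mu)
    (ergodic_T : ergodic mu (T : borelType G -> borelType G)) :
  exists S : full_shift_system,
    topologically_conjugate T (limit_shift S).
Proof.
have [S TS ST] := bijective_T.
have TM : {morph T : x y / x * y} by exact: gmulfM.
have cS : continuous S.
  exact: (bijective_endomorphism_open second_countable_G hausdorff_G haar_mu
    locally_compact_G totally_disconnected_G TM TS ST continuous_T).
pose T' := TopAut TS ST TM continuous_T cS.
apply: (@transitive_conjugate_inverse_limit G T') => //.
exact: (@ergodic_transitive _ _ _ second_countable_G haar_mu T' ergodic_T).
Qed.
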